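(* Let $\mathcal{V}=\oplus_{i\in\mathbb{Z}}\mathcal{V}_i$ be a graded $\mathbb{C}[\partial]$-module. For $n\in\mathbb{Z}$ put $C^n_{cs}(\mathcal{V})=\prod_{k\ge 1}\mathrm{Hom}^n_{cs}(\mathcal{V}^{\otimes k},\mathcal{V}[\lambda_1,\ldots,\lambda_{k-1}])$, whose elements are written as sums $\rho=\sum_{k\ge1}\rho_k$, and let $C^\bullet_{cs}(\mathcal{V})=\oplus_{n\in\mathbb{Z}}C^n_{cs}(\mathcal{V})$. For $\rho=\sum_{k\ge1}\rho_k\in C^n_{cs}(\mathcal{V})$ and $\varrho=\sum_{l\ge1}\varrho_l\in C^m_{cs}(\mathcal{V})$ define $$[\![\rho,\varrho]\!]=\sum_{p\ge1}\ \sum_{k+l=p+1}\big(\rho_k\diamond\varrho_l-(-1)^{mn}\varrho_l\diamond\rho_k\big).$$ Then $(C^\bullet_{cs}(\mathcal{V}),[\![\ ,\ ]\!])$ is a graded Lie algebra.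
   Context: All vector spaces, linear maps and tensor products are over $\mathbb{C}$. A graded $\mathbb{C}[\partial]$-module is $\mathcal{V}=\oplus_{i\in\mathbb{Z}}\mathcal{V}_i$ with each $\mathcal{V}_i$ a $\mathbb{C}[\partial]$-module; $|v|$ is the degree of a homogeneous element $v$. The space $\mathcal{V}[\lambda_1,\ldots,\lambda_{k-1}]=\oplus_i\mathcal{V}_i[\lambda_1,\ldots,\lambda_{k-1}]$ is graded, and $\partial$ acts on it coefficientwise. A $\mathbb{C}$-linear map $\varphi:\mathcal{V}^{\otimes k}\to\mathcal{V}[\lambda_1,\ldots,\lambda_{k-1}]$ is conformal sesquilinear if $\varphi_{\lambda_1,\ldots,\lambda_{k-1}}(v_1,\ldots,\partial v_i,\ldots,v_k)=-\lambda_i\,\varphi_{\lambda_1,\ldots,\lambda_{k-1}}(v_1,\ldots,v_k)$ for $1\le i\le k-1$, and $\varphi_{\lambda_1,\ldots,\lambda_{k-1}}(v_1,\ldots,v_{k-1},\partial v_k)=(\partial+\lambda_1+\cdots+\lambda_{k-1})\varphi_{\lambda_1,\ldots,\lambda_{k-1}}(v_1,\ldots,v_k)$ (for $k=1$: $\varphi$ is $\mathbb{C}[\partial]$-linear). $\mathrm{Hom}^n_{cs}(\mathcal{V}^{\otimes k},\mathcal{V}[\lambda_1,\ldots,\lambda_{k-1}])$ is the space of conformal sesquilinear maps that are homogeneous of degree $n$. Maps are extended linearly over polynomials in the $\lambda$'s when composed. For $\rho_k$ of arity $k$ and degree $n$, and $\varrho_l$ of arity $l$ and degree $m$, with $p=k+l-1$,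 $$(\rho_k\diamond\varrho_l)_{\lambda_1,\ldots,\lambda_{p-1}}(v_1,\ldots,v_p)=\sum_{i=1}^k(-1)^{m(|v_1|+\cdots+|v_{i-1}|)}(\rho_k)_{\lambda_1,\ldots,\lambda_{i-1},\lambda_i+\cdots+\lambda_{i+l-1},\lambda_{i+l},\ldots,\lambda_{p-1}}\big(v_1,\ldots,v_{i-1},(\varrho_l)_{\lambda_i,\ldots,\lambda_{i+l-2}}(v_i,\ldots,v_{i+l-1}),v_{i+l},\ldots,v_p\big),$$ where for $i=k$ the subscripts of $\rho_k$ are just $\lambda_1,\ldots,\lambda_{k-1}$. A graded Lie algebra is a graded vector space with a degree $0$ bracket satisfying graded skew-symmetry $[x,y]=-(-1)^{|x||y|}[y,x]$ and the graded Jacobi identity $[x,[y,z]]=[[x,y],z]+(-1)^{|x||y|}[y,[x,z]]$. *)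

(* Defs.v *)
From HB Require Import structures.
From mathcomp Require Import all_boot all_order all_algebra.
From mathcomp Require Import finmap mpoly.
From mathcomp Require Import boolp classical_sets functions cardinality fsbigop.
From mathcomp Require Import reals complex.

Set Implicit Arguments.
Unset Strict Implicit.
Unset Printing Implicit Defensive.

Import GRing.Theory.

Local Open Scope classical_set_scope.
Local Open Scope ring_scope.

(* Arities and numbers of variables: a cochain of index [k] has arity [k.+1],
   takes the arguments [v_0, ..., v_k] and has values in the polynomials in
   the [k] variables [lambda_0, ..., lambda_(k-1)].  All positions are counted
   from 0. *)

Section DirectProduct.
Variables (K : pzRingType) (I : Type) (V : I -> lmodType K).

Definition dirprod : Type := forall i, V i.

HB.instance Definition _ := gen_eqMixin dirprod.
HB.instance Definition _ := gen_choiceMixin dirprod.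

Implicit Types f g h : dirprod.

Lemma dirprodP f g : (forall i, f i = g i) -> f = g.
Proof. exact: functional_extensionality_dep. Qed.

Definition dirprod_add f g : dirprod := fun i => f i + g i.
Definition dirprod_opp f : dirprod := fun i => - f i.
Definition dirprod_scale (a : K) f : dirprod := fun i => a *: f i.

Fact dirprod_addA : associative dirprod_add.
Proof. by move=> f g h; apply: dirprodP => i; exact: addrA. Qed.
Fact dirprod_addC : commutative dirprod_add.
Proof. by move=> f g; apply: dirprodP => i; exact: addrC. Qed.
Fact dirprod_add0 : left_id (fun i => 0 : V i) dirprod_add.
Proof. by move=> f; apply: dirprodP => i; exact: add0r. Qed.
Fact dirprod_addN : left_inverse (fun i => 0 : V i) dirprod_opp dirprod_add.
Proof. by move=> f; apply: dirprodP => i; exact: addNr. Qed.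

HB.instance Definition _ := GRing.isZmodule.Build dirprod
  dirprod_addA dirprod_addC dirprod_add0 dirprod_addN.

Fact dirprod_scaleA a b f :
  dirprod_scale a (dirprod_scale b f) = dirprod_scale (a * b) f.
Proof. by apply: dirprodP => i; exact: scalerA. Qed.
Fact dirprod_scale1 : left_id 1 dirprod_scale.
Proof. by move=> f; apply: dirprodP => i; exact: scale1r. Qed.
Fact dirprod_scaleDr : right_distributive dirprod_scale +%R.
Proof. by move=> a f g; apply: dirprodP => i; exact: scalerDr. Qed.
Fact dirprod_scaleDl f : {morph dirprod_scale^~ f : a b / a + b}.
Proof. by move=> a b; apply: dirprodP => i; exact: scalerDl. Qed.

HB.instance Definition _ := GRing.Zmodule_isLmodule.Build K dirprod
  dirprod_scaleA dirprod_scale1 dirprod_scaleDr dirprod_scaleDl.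

Lemma dirprodD f g i : (f + g) i = f i + g i. Proof. by []. Qed.
Lemma dirprodZ a f i : (a *: f) i = a *: f i. Proof. by []. Qed.

End DirectProduct.

Section DirectSum.
Variables (K : pzRingType) (I : choiceType) (V : I -> lmodType K).

Definition finitely_supported : {pred dirprod V} :=
  fun f => `[< finite_set [set i | f i != 0] >].

Fact finitely_supported_submod : submod_closed finitely_supported.
Proof.
split=> [|a f g /asboolP fin_f /asboolP fin_g]; apply/asboolP.
  by apply: (sub_finite_set _ (@finite_set0 I)) => i /=; rewrite eqxx.
apply: (@sub_finite_set _ _ ([set i | f i != 0] `|` [set i | g i != 0])).
  move=> i /= nz; apply/orP; rewrite -negb_and; apply: contra nz.
  by rewrite dirprodD dirprodZ => /andP[/eqP-> /eqP->]; rewrite scaler0 addr0.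
by rewrite finite_setU.
Qed.

HB.instance Definition _ :=
  GRing.isSubmodClosed.Build K (dirprod V) finitely_supported
    finitely_supported_submod.

Record dirsum : Type := DirSum {
  dirsum_val : dirprod V;
  _ : dirsum_val \in finitely_supported }.

HB.instance Definition _ := [isSub for dirsum_val].
HB.instance Definition _ := [Choice of dirsum by <:].
HB.instance Definition _ := [SubChoice_isSubLmodule of dirsum by <:].

Definition dirsum_comp (x : dirsum) : forall i, V i := dirsum_val x.
Coercion dirsum_comp : dirsum >-> Funclass.

Fact dirinj_subproof i (v : V i) :
  (dfwith (fun j => 0 : V j) v : dirprod V) \in finitely_supported.
Proof.
apply/asboolP; apply: (sub_finite_set _ (finite_set1 i)) => j /=.
by apply: contra_neqP => /eqP nij; rewrite dfwith_out // eq_sym.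
Qed.

Definition dirinj i (v : V i) : dirsum := DirSum (dirinj_subproof v).

End DirectSum.

Lemma linear_at0 (K : pzRingType) (U W : lmodType K) (f : U -> W) :
  linear f -> f 0 = 0.
Proof.
move=> linf; have := linf (-1) 0 0.
by rewrite scaleN1r oppr0 addr0 scaleN1r addNr.
Qed.

Section DirectSumTheory.
Variables (K : pzRingType) (I : choiceType) (V : I -> lmodType K).
Variable W : lmodType K.

Lemma fsum_dirsum_linear (F : forall i, V i -> W) :
  (forall i, linear (F i)) ->
  linear (fun x : dirsum V => \sum_(i \in [set: I]) F i (x i)).
Proof.
move=> linF a x y.
have F0 i : F i 0 = 0 by exact: linear_at0.
have fin z : finite_set [set i | (z : dirsum V) i != 0].
  by case: z => z /= /asboolP.
pose A := fset_set ([set i | x i != 0] `|` [set i | y i != 0]).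
have memA i : i \notin A -> x i = 0 /\ y i = 0.
  rewrite /A in_fset_set; last by rewrite finite_setU.
  rewrite notin_setE /= => /not_orP[/negP xi /negP yi].
  by split; apply/eqP; rewrite -[_ == _]negbK.
rewrite !(@fsbigTE _ _ _ _ A) => [|i /memA[]|i /memA[]|i /memA[x0 y0]] //.
- rewrite scaler_sumr -big_split; apply: eq_bigr => i _; exact: linF.
- by move=> _ ->.
- by move=> -> _.
- have -> : (a *: x + y) i = a *: x i + y i by [].
  by rewrite x0 y0 scaler0 addr0.
Qed.

Lemma dirinj_linear i : linear (@dirinj K I V i).
Proof.
move=> a u w; apply: val_inj; apply: dirprodP => j /=.
rewrite [RHS]/= dirprodD dirprodZ /=; case: (eqVneq i j) => [<-|nij].
  by rewrite !dfwith_in.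
by rewrite !dfwith_out // scaler0 addr0.
Qed.

End DirectSumTheory.

Section Homogeneous.
Variables (K : pzRingType) (V : int -> lmodType K).

Definition homogeneous (i : int) (x : dirsum V) : Prop :=
  forall j, j != i -> x j = 0.

End Homogeneous.

Section GradedLieAlgebra.
Variables (K : fieldType) (L : int -> lmodType K).

Record graded_Lie_algebra (br : dirsum L -> dirsum L -> dirsum L) : Prop := {
  gLie_linearl : forall y, linear (br^~ y);
  gLie_linearr : forall x, linear (br x);
  gLie_degree : forall n m x y,
    homogeneous n x -> homogeneous m y -> homogeneous (n + m) (br x y);
  gLie_skew : forall n m x y, homogeneous n x -> homogeneous m y ->
    br x y = - ((-1) ^ (n * m) *: br y x);
  gLie_Jacobi : forall n m l x y z,
    homogeneous n x -> homogeneous m y -> homogeneous l z ->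
    br x (br y z) = br (br x y) z + (-1) ^ (n * m) *: br y (br x z) }.

End GradedLieAlgebra.

Section VectorPolynomials.
Variables (K : fieldType) (W : lmodType K).

(* W[lambda_0, ..., lambda_(n-1)]; [dirinj a w] is the monomial
   [w lambda^a], and the coefficient of [lambda^a] in [P] is [P a]. *)
Definition lpoly (n : nat) : lmodType K := dirsum (fun _ : 'X_{1..n} => W).

Definition lmono n (a : 'X_{1..n}) (w : W) : lpoly n :=
  @dirinj K _ (fun _ : 'X_{1..n} => W) a w.

(* The product of a scalar polynomial and a vector. *)
Definition ltens n (q : {mpoly K[n]}) (w : W) : lpoly n :=
  \sum_(a <- msupp q) lmono a (q@_a *: w).

(* The K[lambda]-module structure. *)
Definition lscale n (q : {mpoly K[n]}) (P : lpoly n) : lpoly n :=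
  \sum_(a \in [set: 'X_{1..n}]) ltens (q * 'X_[a]) (P a).

(* Substitution of [f j] for [lambda_j]. *)
Definition lsubst n p (f : 'I_n -> {mpoly K[p]}) (P : lpoly n) : lpoly p :=
  \sum_(a \in [set: 'X_{1..n}]) ltens (\prod_j f j ^+ a j) (P a).

(* The K[lambda]-linear extension to W[lambda] of a map defined on W. *)
Definition lextend n (g : W -> lpoly n) (P : lpoly n) : lpoly n :=
  \sum_(a \in [set: 'X_{1..n}]) lscale 'X_[a] (g (P a)).

Lemma ltens_linear n (q : {mpoly K[n]}) : linear (@ltens n q).
Proof.
move=> c u w; rewrite /ltens scaler_sumr -big_split; apply: eq_bigr => a _ /=.
by rewrite scalerDr scalerA mulrC -scalerA /lmono dirinj_linear.
Qed.

Lemma lscale_linear n (q : {mpoly K[n]}) : linear (@lscale n q).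
Proof.
apply: (@fsum_dirsum_linear K _ (fun _ : 'X_{1..n} => W) (lpoly n)
  (fun a w => ltens (q * 'X_[a]) w)) => a; exact: ltens_linear.
Qed.

End VectorPolynomials.

Section Cochains.
Variables (K : fieldType) (V : int -> lmodType K).
(* The action of the derivation on each component; the C[d]-module V_i is the
   vector space [V i] with the endomorphism [d i]. *)
Variable d : forall i, {linear V i -> V i}.

Definition gpartial (x : dirsum V) : dirsum V :=
  \sum_(i \in [set: int]) dirinj (d i (x i)).

Definition gpartial_poly n (P : lpoly (dirsum V) n) : lpoly (dirsum V) n :=
  \sum_(a \in [set: 'X_{1..n}]) lmono a (gpartial (P a)).

(* The linear map sending a homogeneous [v] to [(-1) ^ (m * |v|) *: v]; applied
   to each of the arguments on the left of a map of degree [m], it produces the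
   sign of the composition product. *)
Definition koszul (m : int) (x : dirsum V) : dirsum V :=
  \sum_(i \in [set: int]) dirinj ((-1) ^ (m * i) *: x i).

Definition cochain (k : nat) : lmodType K :=
  ('I_k.+1 -> dirsum V) -> lpoly (dirsum V) k.

(* A linear map on the k-fold tensor power is a multilinear map. *)
Definition multilinear k (phi : cochain k) : Prop :=
  forall (v : 'I_k.+1 -> dirsum V) (i : 'I_k.+1) (a : K) (x y : dirsum V),
    phi [eta v with i |-> a *: x + y] =
    a *: phi [eta v with i |-> x] + phi [eta v with i |-> y].

Definition conformal_sesquilinear k (phi : cochain k) : Prop :=
  (forall (v : 'I_k.+1 -> dirsum V) (i : 'I_k),
     let j := widen_ord (leqnSn k) i in
     phi [eta v with j |-> gpartial (v j)] = - lscale 'X_i (phi v)) /\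
  (forall v : 'I_k.+1 -> dirsum V,
     phi [eta v with ord_max |-> gpartial (v ord_max)] =
     gpartial_poly (phi v) + lscale (\sum_(i < k) 'X_i) (phi v)).

Definition homogeneous_map k (n : int) (phi : cochain k) : Prop :=
  forall (v : 'I_k.+1 -> dirsum V) (e : 'I_k.+1 -> int),
    (forall j, homogeneous (e j) (v j)) ->
    forall a, homogeneous (\sum_j e j + n) (phi v a).

Definition cs_cochain (n : int) k : {pred cochain k} := fun phi =>
  `[< [/\ multilinear phi, conformal_sesquilinear phi
        & homogeneous_map n phi] >].

Lemma gpartial_linear : linear gpartial.
Proof.
apply: (fsum_dirsum_linear (F := fun i v => dirinj (d i v))) => i a u w.
by rewrite linearP dirinj_linear.
Qed.

Lemma gpartial_poly_linear n : linear (@gpartial_poly n).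
Proof.
apply: (@fsum_dirsum_linear K _ (fun _ : 'X_{1..n} => dirsum V) (lpoly _ n)
  (fun a w => lmono a (gpartial w))) => i a u w.
by rewrite gpartial_linear /lmono dirinj_linear.
Qed.

Fact cs_cochain_submod n k : submod_closed (@cs_cochain n k).
Proof.
split=> [|c phi psi /asboolP[mphi [sphi tphi] hphi]
                    /asboolP[mpsi [spsi tpsi] hpsi]]; last first.
  have evE v : (c *: phi + psi) v = c *: phi v + psi v by [].
  apply/asboolP; split.
  - move=> v i a x y; rewrite !evE mphi mpsi.
    by rewrite !scalerDr !scalerA [c * a]mulrC addrACA.
  - split=> [v i j|v]; rewrite !evE.
      by rewrite sphi spsi lscale_linear opprD scalerN.
    rewrite tphi tpsi lscale_linear gpartial_poly_linear.
    by rewrite scalerDr addrACA.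
  - move=> v e hv a j nj; rewrite evE.
    have -> : (c *: phi v + psi v) a j = c *: phi v a j + psi v a j by [].
    by rewrite (hphi v e hv a j nj) (hpsi v e hv a j nj) scaler0 addr0.
apply/asboolP; split.
- by move=> v i a x y; rewrite scaler0 addr0.
- split=> [v i j|v]; first by rewrite (linear_at0 (lscale_linear _)) oppr0.
  rewrite (linear_at0 (lscale_linear _)).
  by rewrite (linear_at0 (@gpartial_poly_linear k)) addr0.
- by [].
Qed.

HB.instance Definition _ n k :=
  GRing.isSubmodClosed.Build K (cochain k) (@cs_cochain n k)
    (@cs_cochain_submod n k).

(* Homogeneous conformal sesquilinear maps of degree [n] and arity [k.+1]. *)
Record cs_hom (n : int) (k : nat) : Type := CsHom {
  cs_hom_val :> cochain k;
  _ : cs_hom_val \in @cs_cochain n k }.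

HB.instance Definition _ n k := [isSub for @cs_hom_val n k].
HB.instance Definition _ n k := [Choice of cs_hom n k by <:].
HB.instance Definition _ n k := [SubChoice_isSubLmodule of cs_hom n k by <:].

Definition cs_deg (n : int) : lmodType K := dirprod (fun k => cs_hom n k).

(* An element of degree [n] is [dirinj rho] with [rho : cs_deg n]. *)
Definition cs_complex : lmodType K := dirsum cs_deg.

(* The variable lambda_j; the default value 0 is never used below, where j < p
   as soon as p = k + l. *)
Definition lvar p (j : nat) : {mpoly K[p]} :=
  if insub j is Some i then 'X_i else 0.

Section Diamond.
Variables (m : int) (k l p : nat).
Variables (rho : cochain k) (vrho : cochain l).
Implicit Types (i : 'I_k.+1) (v : 'I_p.+1 -> dirsum V) (w : dirsum V).

Definition inner_args i v : 'I_l.+1 -> dirsum V :=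
  fun j => v (inord (i + j)).

Definition inner_vars i : 'I_l -> {mpoly K[p]} := fun j => lvar p (i + j).

Definition outer_args i v w : 'I_k.+1 -> dirsum V := fun j =>
  if (j < i)%N then koszul m (v (inord j))
  else if j == i then w
  else v (inord (j + l)).

Definition outer_vars i : 'I_k -> {mpoly K[p]} := fun j =>
  if (j < i)%N then lvar p j
  else if j == i :> nat then \sum_(s < l.+1) lvar p (i + s)
  else lvar p (j + l).

(* Only meaningful for [p = k + l], the arity of the result being
   (k + 1) + (l + 1) - 1; [m] is the degree of [vrho].  In the last slot,
   [i = k], no index [j : 'I_k] satisfies [i <= j], so that the subscripts of
   [rho] are lambda_0, ..., lambda_(k-1). *)
Definition diamond : cochain p := fun v =>
  \sum_(i < k.+1)
    lextend (fun w => lsubst (outer_vars i) (rho (outer_args i v w)))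
      (lsubst (inner_vars i) (vrho (inner_args i v))).

End Diamond.

Arguments diamond m {k l} p rho vrho.

(* The component of arity [p.+1] of the bracket of two homogeneous elements. *)
Definition cs_bracket n m (rho : cs_deg n) (vrho : cs_deg m) p : cochain p :=
  \sum_(k < p.+1) \sum_(l < p.+1 | (k + l == p)%N)
    (diamond m p (rho k) (vrho l)
     - (-1) ^ (m * n) *: diamond n p (vrho l) (rho k)).

End Cochains.

Arguments cs_bracket {K V d n m} rho vrho p.

(* Main.v *)
(* Over a field of characteristic 0 a polynomial with vector coefficients is
   determined by its values, so every identity can be checked after replacing
   the variables lambda_i by scalars z_i.  A cochain then becomes a function on
   lists of pairs (z_i, v_i), the last scalar being a dummy, and plugging
   sigma into an argument of rho replaces a sublist by the single pair
   (sum of its z_i, value of sigma on it).  The composition product is thus a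
   sum over the factorizations of a list into three pieces.  By coassociativity
   of deconcatenation it is graded right pre-Lie: the associator of rho, sigma
   and tau is the sum of the terms in which sigma and tau are plugged into
   distinct arguments of rho, hence graded symmetric in sigma and tau.  The
   graded commutator of a pre-Lie product is a graded Lie bracket. *)
Require Import Defs.
From mathcomp Require Import all_boot all_order all_algebra zify.
From mathcomp Require Import finmap mpoly.
From mathcomp Require Import boolp classical_sets functions cardinality fsbigop.
From mathcomp Require Import reals complex.

Set Implicit Arguments.
Unset Strict Implicit.
Unset Printing Implicit Defensive.

Import Order.TTheory GRing.Theory Num.Theory.

Local Open Scope ring_scope.

(** * Deconcatenation sums *)

Section Deconcatenation.
Variable E : Type.

(** Structural recursion over the cuts [s = a ++ b], in place of a sum indexed by [take] and [drop],
    lets the identities below follow by induction on [s] with [Phi] generalized. *)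
Fixpoint deconc (M : nmodType) (Phi : seq E -> seq E -> M) (s : seq E) : M :=
  Phi [::] s + if s is x :: s' then deconc (fun a b => Phi (x :: a) b) s' else 0.

Definition deconc3 (M : nmodType) (Psi : seq E -> seq E -> seq E -> M) s : M :=
  deconc (fun a r => deconc (Psi a) r) s.

Variable M : nmodType.
Implicit Types (Phi : seq E -> seq E -> M) (Psi : seq E -> seq E -> seq E -> M).

Lemma deconcE Phi s :
  deconc Phi s = \sum_(i < (size s).+1) Phi (take i s) (drop i s).
Proof.
elim: s Phi => [|x s IHs] Phi; first by rewrite big_ord1 /= addr0.
by rewrite big_ord_recl /= IHs.
Qed.

Lemma deconc_ind (P : M -> Prop) Phi s :
  P 0 -> (forall x y, P x -> P y -> P (x + y)) ->
  (forall a b, a ++ b = s -> P (Phi a b)) -> P (deconc Phi s).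
Proof.
move=> P0 PD; elim: s Phi => [|x s IHs] Phi PPhi /=.
  by rewrite addr0; exact: PPhi.
by apply: PD; [exact: PPhi|apply: IHs => a b eqs; apply: PPhi; rewrite -eqs].
Qed.

Lemma eq_deconc Phi Phi' s :
  (forall a b, a ++ b = s -> Phi a b = Phi' a b) -> deconc Phi s = deconc Phi' s.
Proof.
elim: s Phi Phi' => [|x s IHs] Phi Phi' eqPhi /=.
  by rewrite eqPhi.
by rewrite eqPhi //; congr (_ + _); apply: IHs => a b eqs; rewrite eqPhi//= eqs.
Qed.

Lemma deconcD Phi Phi' s :
  deconc (fun a b => Phi a b + Phi' a b) s = deconc Phi s + deconc Phi' s.
Proof.
elim: s Phi Phi' => [|x s IHs] Phi Phi' /=; first by rewrite !addr0.
by rewrite IHs addrACA.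
Qed.

Lemma deconc_morph (M' : nmodType) (f : M -> M') Phi s :
  f 0 = 0 -> {morph f : x y / x + y} ->
  f (deconc Phi s) = deconc (fun a b => f (Phi a b)) s.
Proof.
move=> f0 fD; elim: s Phi => [|x s IHs] Phi /=; first by rewrite !addr0.
by rewrite fD IHs.
Qed.

End Deconcatenation.

Section DeconcatenationTheory.
Variables (E : Type) (M : nmodType).
Implicit Types (Phi : seq E -> seq E -> M) (Psi : seq E -> seq E -> seq E -> M).

Lemma deconc_map (g : E -> E) Phi s :
  deconc Phi (map g s) = deconc (fun a b => Phi (map g a) (map g b)) s.
Proof. by elim: s Phi => [|x s IHs] Phi //=; rewrite IHs. Qed.

(** Coassociativity of deconcatenation: whichever cut comes first, both sides run over the
    factorizations [a ++ b ++ c = s]. *)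
Lemma deconcA Psi s :
  deconc3 Psi s = deconc (fun r c => deconc (fun a b => Psi a b c) r) s.
Proof.
rewrite /deconc3; elim: s Psi => [|x s IHs] Psi /=; first by rewrite !addr0.
by rewrite IHs !deconcD addr0 addrA.
Qed.

(** The cut falls either to the left or to the right of the marked letter [x]. *)
Lemma deconc_insert Phi a x b :
  deconc Phi (a ++ x :: b) =
  deconc (fun c d => Phi c (d ++ x :: b)) a +
  deconc (fun c d => Phi (a ++ x :: c) d) b.
Proof. by elim: a Phi => [|y a IHa] Phi /=; rewrite ?addr0// IHa addrA. Qed.

Lemma deconc3_nil Psi : deconc3 Psi [::] = Psi [::] [::] [::].
Proof. by rewrite /deconc3 /= !addr0. Qed.

Lemma eq_deconc3 Psi Psi' s :
  (forall a b c, a ++ b ++ c = s -> Psi a b c = Psi' a b c) ->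
  deconc3 Psi s = deconc3 Psi' s.
Proof.
move=> eqPsi; apply: eq_deconc => a r eqs; apply: eq_deconc => b c eqr.
by apply: eqPsi; rewrite eqr.
Qed.

Lemma deconc3D Psi Psi' s :
  deconc3 (fun a b c => Psi a b c + Psi' a b c) s = deconc3 Psi s + deconc3 Psi' s.
Proof. by rewrite -deconcD; apply: eq_deconc => a r _; rewrite deconcD. Qed.

Lemma deconc3_morph (M' : nmodType) (f : M -> M') Psi s :
  f 0 = 0 -> {morph f : x y / x + y} ->
  f (deconc3 Psi s) = deconc3 (fun a b c => f (Psi a b c)) s.
Proof.
move=> f0 fD; rewrite deconc_morph//; apply: eq_deconc => a r _.
exact: deconc_morph.
Qed.

Lemma deconc3_map (g : E -> E) Psi s :
  deconc3 Psi (map g s) = deconc3 (fun a b c => Psi (map g a) (map g b) (map g c)) s.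
Proof.
by rewrite /deconc3 deconc_map; apply: eq_deconc => a r _; rewrite deconc_map.
Qed.

Lemma deconc3_ind (P : M -> Prop) Psi s :
  P 0 -> (forall x y, P x -> P y -> P (x + y)) ->
  (forall a b c, a ++ b ++ c = s -> P (Psi a b c)) -> P (deconc3 Psi s).
Proof.
move=> P0 PD PPsi; apply: deconc_ind => // a r eqs; apply: deconc_ind => // b c eqr.
by apply: PPsi; rewrite eqr.
Qed.

(** The three summands have [x] in the third, the second and the first piece. *)
Lemma deconc3_insert Psi a x b :
  deconc3 Psi (a ++ x :: b) =
  deconc3 (fun c d e => Psi c d (e ++ x :: b)) a +
  deconc (fun c d => deconc (fun e f => Psi c (d ++ x :: e) f) b) a +
  deconc3 (fun c d e => Psi (a ++ x :: c) d e) b.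
Proof.
rewrite /deconc3 deconc_insert; congr (_ + _); rewrite -deconcD.
by apply: eq_deconc => c d _; rewrite deconc_insert.
Qed.

Lemma exchange_deconc (Ups : seq E -> seq E -> seq E -> seq E -> M) s t :
  deconc (fun a b => deconc (Ups a b) t) s =
  deconc (fun c d => deconc (fun a b => Ups a b c d) s) t.
Proof.
elim: s Ups => [|x s IHs] Ups /=.
  by rewrite addr0; apply: eq_deconc => a b _; rewrite addr0.
by rewrite IHs -deconcD.
Qed.

(** Sums over factorizations into five pieces. The three lemmas below obtain the same sum by
    refining other pieces of a factorization into three, as needed to compare iterated
    compositions. *)
Definition deconc5 (Ups : seq E -> seq E -> seq E -> seq E -> seq E -> M) s :=
  deconc3 (fun a b r => deconc3 (Ups a b) r) s.

Lemma deconc5_first (Ups : seq E -> seq E -> seq E -> seq E -> seq E -> M) s :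
  deconc3 (fun r d e => deconc3 (fun a b c => Ups a b c d e) r) s = deconc5 Ups s.
Proof.
(* The cuts of [r] and of [q] are independent, so their sums can be exchanged; coassociativity then
   merges nested cuts. *)
transitivity (deconc (fun r q => deconc (fun a q' =>
    deconc (fun d e => deconc (fun b c => Ups a b c d e) q') q) r) s).
  by apply: eq_deconc => r q _; rewrite -exchange_deconc.
rewrite -deconcA; apply: eq_deconc => a R _.
transitivity (deconc (fun q' q => deconc (fun b c =>
    deconc (fun d e => Ups a b c d e) q) q') R).
  by apply: eq_deconc => q' q _; rewrite exchange_deconc.
by rewrite -deconcA.
Qed.

Lemma deconc5_mid (Ups : seq E -> seq E -> seq E -> seq E -> seq E -> M) s :
  deconc3 (fun a r e => deconc3 (fun b c d => Ups a b c d e) r) s = deconc5 Ups s.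
Proof.
apply: eq_deconc => a R _; rewrite -deconcA; apply: eq_deconc => b S _.
by rewrite -deconcA.
Qed.

Lemma deconc5_sides (Ups : seq E -> seq E -> seq E -> seq E -> seq E -> M) s :
  deconc3 (fun r c q => deconc (fun a b => deconc (fun d e => Ups a b c d e) q) r) s
  = deconc5 Ups s.
Proof.
transitivity (deconc (fun r q => deconc (fun a b =>
    deconc (fun c q' => deconc (fun d e => Ups a b c d e) q') q) r) s).
  by apply: eq_deconc => r q _; rewrite -exchange_deconc.
by rewrite -deconcA.
Qed.

End DeconcatenationTheory.

Section DeconcatenationScale.
Variables (K : pzRingType) (E : Type) (M : lmodType K) (k : K).

Lemma deconcZ (Phi : seq E -> seq E -> M) s :
  k *: deconc Phi s = deconc (fun a b => k *: Phi a b) s.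
Proof. exact: (deconc_morph (f := *:%R k) _ _ (scaler0 _ _) (scalerDr _)). Qed.

Lemma deconc3Z (Psi : seq E -> seq E -> seq E -> M) s :
  k *: deconc3 Psi s = deconc3 (fun a b c => k *: Psi a b c) s.
Proof. exact: (deconc3_morph (f := *:%R k) _ _ (scaler0 _ _) (scalerDr _)). Qed.

End DeconcatenationScale.

(** * Direct sums and Koszul signs *)

Section LinearMaps.
Variables (K : pzRingType) (U W : lmodType K) (f : U -> W).
Hypothesis linf : linear f.

Lemma linear_addE : {morph f : x y / x + y}.
Proof. by move=> x y; have := linf 1 x y; rewrite !scale1r. Qed.

Lemma linear_scaleE a : {morph f : x / a *: x}.
Proof. by move=> x; have := linf a x 0; rewrite (linear_at0 linf) !addr0. Qed.

Lemma linear_oppE : {morph f : x / - x}.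
Proof. by move=> x; rewrite -!scaleN1r linear_scaleE. Qed.

Lemma linear_sumE (I : Type) (r : seq I) (P : pred I) (F : I -> U) :
  f (\sum_(i <- r | P i) F i) = \sum_(i <- r | P i) f (F i).
Proof. exact: (big_morph f linear_addE (linear_at0 linf)). Qed.

End LinearMaps.

Section DirectSumExtensionality.
Variables (K : pzRingType) (I : choiceType) (V : I -> lmodType K).
Implicit Types x : dirsum V.

Lemma dirsumP (x y : dirsum V) : (forall i, x i = y i) -> x = y.
Proof. by move=> eqxy; apply: val_inj; apply: dirprodP => i; exact: eqxy. Qed.

Lemma dirsumDE (x y : dirsum V) i : (x + y) i = x i + y i. Proof. by []. Qed.
Lemma dirsumZE a x i : (a *: x) i = a *: x i. Proof. by []. Qed.

Lemma dirsum_comp_linear i : linear (fun x : dirsum V => x i).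
Proof. by []. Qed.

Lemma dirinj_in i (v : V i) : dirinj v i = v.
Proof. exact: dfwith_in. Qed.

Lemma dirinj_out i j (v : V i) : i != j -> dirinj v j = 0.
Proof. by move=> nij; exact: dfwith_out. Qed.

Lemma dirsum_support x : exists A : {fset I}, forall i, i \notin A -> x i = 0.
Proof.
case: x => f /[dup] /asboolP fin_f Hf.
exists (fset_set [set i | f i != 0]%classic) => i.
rewrite in_fset_set // notin_setE /= => /negP; rewrite negbK => /eqP; exact.
Qed.

Lemma dirsum_expand x (A : {fset I}) : (forall i, i \notin A -> x i = 0) ->
  x = \sum_(i <- A) dirinj (x i).
Proof.
move=> suppA; apply: dirsumP => j; rewrite (linear_sumE (dirsum_comp_linear j)).
case: (boolP (j \in A)) => [jA|njA].
  rewrite (big_fsetD1 _ jA) dirinj_in big_seq big1 => [|i]; first exact/esym/addr0.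
  by rewrite in_fsetD1 => /andP[nij _]; rewrite dirinj_out.
rewrite suppA// big_seq big1 // => i iA; rewrite dirinj_out //.
by apply: contraNneq njA => <-.
Qed.

Lemma dirsum_ind (P : dirsum V -> Prop) :
  P 0 -> (forall x y, P x -> P y -> P (x + y)) ->
  (forall i (v : V i), P (dirinj v)) -> forall x, P x.
Proof.
move=> P0 PD Pinj x; have [A suppA] := dirsum_support x.
by rewrite (dirsum_expand suppA); elim/big_ind: _.
Qed.

Lemma fsum_dirinj (W : nmodType) (F : forall i, V i -> W) j (v : V j) :
  (forall i, F i 0 = 0) -> \sum_(i \in [set: I]) F i (dirinj v i) = F j v.
Proof.
move=> F0; rewrite (@fsbigTE _ _ _ _ [fset j]%fset) => [|i].
  by rewrite big_seq_fset1 dirinj_in.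
by rewrite in_fset1 => nij; rewrite dirinj_out 1?eq_sym.
Qed.

(** Linear operations on vector polynomials are compared below on monomials only, which are the
    injections of the summands. *)
Lemma linear_dirsum_ext (W : lmodType K) (f g : dirsum V -> W) :
  linear f -> linear g ->
  (forall i (v : V i), f (dirinj v) = g (dirinj v)) -> f =1 g.
Proof.
move=> lf lg eqfg; elim/dirsum_ind => // [|x y eqx eqy].
  by rewrite !linear_at0.
by rewrite !linear_addE// eqx eqy.
Qed.

Lemma fsum_map_linear (F : forall i, V i -> V i) :
  (forall i, linear (F i)) ->
  linear (fun x : dirsum V => \sum_(i \in [set: I]) dirinj (F i (x i))).
Proof.
move=> linF.
apply: (@fsum_dirsum_linear K I V _ (fun i v => dirinj (F i v))) => i a u w.
by rewrite linF dirinj_linear.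
Qed.

Lemma fsum_mapE (F : forall i, V i -> V i) x j :
  (forall i, linear (F i)) ->
  (\sum_(i \in [set: I]) dirinj (F i (x i))) j = F j (x j).
Proof.
move=> linF; move: x.
apply: (@linear_dirsum_ext (V j)) => [a x y|a x y|i v].
- by rewrite (fsum_map_linear linF).
- by rewrite -(linF j).
rewrite (@fsum_dirinj _ (fun i v => dirinj (F i v))) => [|k]; last first.
  by rewrite !linear_at0//; exact: dirinj_linear.
have [<-|nij] := eqVneq i j; first by rewrite !dirinj_in.
by rewrite !dirinj_out// (linear_at0 (linF j)).
Qed.

End DirectSumExtensionality.

(** * Koszul twists and homogeneous elements *)

Section Koszul.
Variables (K : fieldType) (V : int -> lmodType K).
Implicit Types (x y : dirsum V) (m n : int).

Definition sgn m : K := (-1) ^ m.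

Lemma sgn0 : sgn 0 = 1. Proof. exact: expr0z. Qed.

Lemma sgnD m n : sgn (m + n) = sgn m * sgn n.
Proof. by rewrite /sgn expfzDr ?oppr_eq0 ?oner_eq0. Qed.

Lemma sgnK m : sgn m * sgn m = 1.
Proof. by rewrite -expfzMl mulrNN mulr1 exp1rz. Qed.

Lemma koszulE m x i : koszul m x i = sgn (m * i) *: x i.
Proof.
apply: (fsum_mapE (F := fun i v => sgn (m * i) *: v)) => j a u w.
by rewrite scalerDr !scalerA mulrC.
Qed.

Lemma koszul_linear m : linear (@koszul _ V m).
Proof.
by move=> a x y; apply: dirsumP => i; rewrite !(dirsumDE, dirsumZE, koszulE)
  scalerDr !scalerA mulrC.
Qed.

Lemma koszul_comp m n x : koszul m (koszul n x) = koszul (m + n) x.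
Proof. by apply: dirsumP => i; rewrite !koszulE scalerA -sgnD mulrDl. Qed.

Lemma koszul_homogeneous m i x :
  homogeneous i x -> koszul m x = sgn (m * i) *: x.
Proof.
move=> hx; apply: dirsumP => j; rewrite koszulE dirsumZE.
by have [->//|/hx->] := eqVneq j i; rewrite !scaler0.
Qed.

Lemma homogeneous0 i : homogeneous i (0 : dirsum V).
Proof. by []. Qed.

Lemma homogeneousD i x y :
  homogeneous i x -> homogeneous i y -> homogeneous i (x + y).
Proof. by move=> hx hy j nij; rewrite dirsumDE hx ?hy ?addr0. Qed.

Lemma homogeneousZ i a x : homogeneous i x -> homogeneous i (a *: x).
Proof. by move=> hx j nij; rewrite dirsumZE hx ?scaler0. Qed.

Lemma homogeneous_dirinj i (v : V i) : homogeneous i (dirinj v).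
Proof. by move=> j nij; rewrite dirinj_out // eq_sym. Qed.

Lemma homogeneous_koszul m i x : homogeneous i x -> homogeneous i (koszul m x).
Proof. by move=> hx; rewrite (koszul_homogeneous _ hx); exact: homogeneousZ. Qed.

Lemma homogeneousE i x : homogeneous i x -> x = dirinj (x i).
Proof.
move=> hx; apply: dirsumP => j; have [->|nij] := eqVneq j i.
  by rewrite dirinj_in.
by rewrite hx// dirinj_out// eq_sym.
Qed.

Variable d : forall i, {linear V i -> V i}.

Lemma gpartialE x i : gpartial d x i = d i (x i).
Proof. by apply: (fsum_mapE (F := d)) => j a u w; rewrite linearP. Qed.

Lemma koszul_gpartial m x : koszul m (gpartial d x) = gpartial d (koszul m x).
Proof.
by apply: dirsumP => i; rewrite !(koszulE, gpartialE) linearZ.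
Qed.

End Koszul.

(** * The composition product on functions of lists *)

Section CompositionProduct.
Variables (K : fieldType) (V : int -> lmodType K).
Local Notation W := (dirsum V).
Local Notation E := (K * W)%type.
Implicit Types (F G H : seq E -> W) (s a b c : seq E).

(** The value of the sum of variables that the composition product substitutes for one variable of
    the outer map. A piece ending the list contributes its dummy too, but its weight then lands in
    the dummy position of the outer list. *)
Definition weight s : K := \sum_(e <- s) e.1.

Definition kappa m (e : E) : E := (e.1, koszul m e.2).

(** The composition product on list functions. The middle piece may be empty; such terms vanish when
    [G [::] = 0] and [F] is linear in each slot. *)
Definition circ m F G s : W :=
  deconc3 (fun a b c => F (map (kappa m) a ++ (weight b, G b) :: c)) s.

Definition slot_linear F :=
  forall a z b, linear (fun x => F (a ++ (z, x) :: b)).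

(** A relation and not a degree function, since the zero vector is homogeneous of every degree. *)
Fixpoint graded_args (s : seq E) (e : int) : Prop :=
  if s is x :: s' then exists2 i, homogeneous i x.2 & graded_args s' (e - i)
  else e = 0.

Definition graded_fun n F :=
  forall s e, graded_args s e -> homogeneous (e + n) (F s).

Lemma weight_nil : weight [::] = 0. Proof. exact: big_nil. Qed.

Lemma weight_cat a b : weight (a ++ b) = weight a + weight b.
Proof. exact: big_cat. Qed.

Lemma weight_cons e b : weight (e :: b) = e.1 + weight b.
Proof. exact: big_cons. Qed.

Lemma weight_kappa m s : weight (map (kappa m) s) = weight s.
Proof. by rewrite /weight big_map. Qed.

Lemma kappa_comp m n s : map (kappa m) (map (kappa n) s) = map (kappa (m + n)) s.
Proof.
by rewrite -map_comp; apply: eq_map => e; rewrite /= /kappa /= koszul_comp.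
Qed.

Lemma graded_args_cat a b e :
  graded_args (a ++ b) e <-> exists2 i, graded_args a i & graded_args b (e - i).
Proof.
elim: a e => [|x a IHa] e /=.
  by split=> [gb|[i ->]]; [exists 0; rewrite ?subr0|rewrite subr0].
split=> [[i hx /IHa[j ga gb]]|[j [i hx ga] gb]].
  exists (i + j); last by rewrite opprD addrA.
  by exists i; rewrite // addrC addKr.
by exists i => //; apply/IHa; exists (j - i); rewrite // opprB addrA addrNK.
Qed.

Lemma graded_args_kappa m s e : graded_args s e -> graded_args (map (kappa m) s) e.
Proof.
elim: s e => [|x s IHs] e //= [i hx /IHs gs]; exists i => //.
exact: homogeneous_koszul.
Qed.

Section SlotLinear.
Variables (F : seq E -> W).
Hypothesis linF : slot_linear F.

Lemma slot0 a z b : F (a ++ (z, 0) :: b) = 0.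
Proof. exact: (linear_at0 (linF a z b)). Qed.

Lemma slotD a z b : {morph (fun x => F (a ++ (z, x) :: b)) : x y / x + y}.
Proof. exact: (linear_addE (linF a z b)). Qed.

Lemma slotZ a z b k x : F (a ++ (z, k *: x) :: b) = k *: F (a ++ (z, x) :: b).
Proof. exact: (linear_scaleE (linF a z b)). Qed.

Lemma kappa_homogeneous m a s e : graded_args s e ->
  F (a ++ map (kappa m) s) = sgn K (m * e) *: F (a ++ s).
Proof.
elim: s a e => [|[z x] s IHs] a e /=; first by move=> ->; rewrite mulr0 sgn0 scale1r.
case=> i hx gs; rewrite {1}/kappa (koszul_homogeneous _ hx) slotZ /= -!cat_rcons.
by rewrite (IHs _ _ gs) scalerA -sgnD -mulrDr addrC subrK.
Qed.

(* Multilinearity reduces to homogeneous arguments, where both sides differ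
   from [F s] by signs. *)
Lemma koszul_slot m n s : graded_fun n F ->
  koszul m (F s) = sgn K (m * n) *: F (map (kappa m) s).
Proof.
move=> grF; rewrite -[s]cat0s map_cat.
(* The induction moves entries one at a time from [s] into a homogeneous prefix [a]. *)
have: exists e, graded_args [::] e by exists 0.
elim: s [::] => [|[z x] s IHs] a [e ga] /=.
  rewrite !cats0 (koszul_homogeneous _ (grF _ _ ga)).
  by rewrite -[map _ a]cat0s (kappa_homogeneous _ _ ga) scalerA -sgnD -mulrDr addrC.
elim/dirsum_ind: x => [|x y eqx eqy|i v].
- by rewrite /kappa /= (linear_at0 (@koszul_linear _ _ m)) !slot0
    (linear_at0 (@koszul_linear _ _ m)) scaler0.
- rewrite /kappa /= (linear_addE (@koszul_linear _ _ m)) !slotD.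
  by rewrite (linear_addE (@koszul_linear _ _ m)) eqx eqy scalerDr.
rewrite -cat_rcons IHs; first by rewrite map_rcons cat_rcons.
exists (e + i); rewrite -cats1; apply/graded_args_cat; exists e => //=.
exists i; first exact: homogeneous_dirinj.
by rewrite addrAC addrK subrr.
Qed.

End SlotLinear.

(* The part of [circ h (circ g F G) H] in which [G] and [H] are plugged into
   different arguments of [F], with [H] on the left of [G]. *)
Definition disjoint_circ g h F G H s : W :=
  deconc5 (fun a b c d e => F (map (kappa (g + h)) a ++
    (weight b, koszul g (H b)) :: map (kappa g) c ++ (weight d, G d) :: e)) s.

(** Plugging [H] first leaves a list with one marked letter; cutting it for [G] puts that letter
    inside the argument of [G], to its left or to its right, which gives the three summands. *)
Lemma circ_circ g h F G H s :
  slot_linear F -> slot_linear G -> graded_fun g G ->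
  circ h (circ g F G) H s = circ (g + h) F (circ h G H) s +
    disjoint_circ g h F G H s + sgn K (h * g) *: disjoint_circ h g F H G s.
Proof.
move=> linF linG grG.
have -> : circ (g + h) F (circ h G H) s = deconc5 (fun a b c d e =>
    F (map (kappa (g + h)) a ++
      (weight (b ++ c ++ d), G (map (kappa h) b ++ (weight c, H c) :: d)) :: e)) s.
  rewrite -deconc5_mid; apply: eq_deconc3 => a r e _.
  rewrite /circ (deconc3_morph _ _ (slot0 linF _ _ _) (slotD linF _ _ _)).
  by apply: eq_deconc3 => b c d <-.
(* With [G] to the left of [H], the twist by [h] acts on the arguments of [G]; pulling it out of [G]
   by [koszul_slot] accounts for the sign. *)
have -> : sgn K (h * g) *: disjoint_circ h g F H G s = deconc5 (fun c d e b f =>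
    F (map (kappa (g + h)) c ++ (weight d, G (map (kappa h) d)) ::
       map (kappa h) e ++ (weight b, H b) :: f)) s.
  rewrite /disjoint_circ /deconc5 deconc3Z.
  apply: eq_deconc3 => a b r _.
  rewrite deconc3Z; apply: eq_deconc3 => c d e _.
  by rewrite (koszul_slot linG _ _ grG) slotZ// scalerA sgnK scale1r [h + g]addrC.
(* In the three summands, in order, the piece fed to [H] is the third, the second and the fourth of
   five; regrouping makes it the middle of the outer factorization. *)
rewrite -[X in X + _ + _]deconc5_sides -[X in _ + _ + X]deconc5_first.
rewrite /disjoint_circ /deconc5 -!deconc3D.
apply: eq_deconc3 => a b c _.
rewrite {1}/circ deconc3_insert [RHS]addrC [RHS]addrA; congr (_ + _ + _).
- rewrite deconc3_map; apply: eq_deconc3 => a1 a2 a3 _.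
  by rewrite kappa_comp weight_kappa.
- rewrite deconc_map; apply: eq_deconc => a1 a2 _; apply: eq_deconc => c1 c2 _.
  by rewrite kappa_comp !weight_cat weight_cons weight_kappa.
by apply: eq_deconc3 => c1 c2 c3 _; rewrite map_cat kappa_comp -catA.
Qed.

(** By [circ_circ] the associator consists of the two disjoint terms, and exchanging [G] and [H]
    swaps them up to the sign. *)
Lemma circ_prelie g h F G H s :
  slot_linear F -> slot_linear G -> slot_linear H ->
  graded_fun g G -> graded_fun h H ->
  circ h (circ g F G) H s - circ (g + h) F (circ h G H) s =
  sgn K (g * h) *: (circ g (circ h F H) G s - circ (g + h) F (circ g H G) s).
Proof.
move=> linF linG linH grG grH.
have cancel (x y z : W) : x + y + z - x = y + z.
  by apply: (addIr x); rewrite subrK -addrA addrC.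
rewrite circ_circ// (@circ_circ h g F H G)// [h + g]addrC !cancel.
by rewrite scalerDr scalerA sgnK scale1r addrC [h * g]mulrC.
Qed.

Lemma circ_linearl m (k : K) F F' G s :
  circ m (fun t => k *: F t + F' t) G s = k *: circ m F G s + circ m F' G s.
Proof. by rewrite /circ deconc3Z -deconc3D. Qed.

Lemma circ_linearr m (k : K) F G G' s : slot_linear F ->
  circ m F (fun t => k *: G t + G' t) s = k *: circ m F G s + circ m F G' s.
Proof.
move=> linF; rewrite /circ deconc3Z -deconc3D.
by apply: eq_deconc3 => a b c _; rewrite linF.
Qed.

(** The summands place the marked entry to the right of, inside, and to the left of the arguments of
    [G]. Only in the last case is it twisted. *)
Lemma circ_insert m F G a z x b :
  circ m F G (a ++ (z, x) :: b) =
  deconc3 (fun c d e =>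
    F ((map (kappa m) c ++ (weight d, G d) :: e) ++ (z, x) :: b)) a +
  deconc (fun c d => deconc (fun e f =>
    F (map (kappa m) c ++
       (weight d + (z + weight e), G (d ++ (z, x) :: e)) :: f)) b) a +
  deconc3 (fun c d e =>
    F (map (kappa m) a ++ (z, koszul m x) ::
       map (kappa m) c ++ (weight d, G d) :: e)) b.
Proof.
rewrite /circ deconc3_insert; congr (_ + _ + _).
- by apply: eq_deconc3 => c d e _; rewrite -catA.
- apply: eq_deconc => c d _; apply: eq_deconc => e f _.
  by rewrite weight_cat weight_cons.
- by apply: eq_deconc3 => c d e _; rewrite map_cat -catA.
Qed.

Lemma circ_slot_linear m F G :
  slot_linear F -> slot_linear G -> slot_linear (circ m F G).
Proof.
move=> linF linG a z b k x y; rewrite !circ_insert.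
rewrite !scalerDr [RHS]addrACA [X in _ = X + _]addrACA; congr (_ + _ + _).
- by rewrite deconc3Z -deconc3D; apply: eq_deconc3 => c d e _; exact: linF.
- rewrite deconcZ -deconcD; apply: eq_deconc => c d _.
  by rewrite deconcZ -deconcD; apply: eq_deconc => e f _; rewrite linG linF.
rewrite deconc3Z -deconc3D; apply: eq_deconc3 => c d e _.
by rewrite koszul_linear linF.
Qed.

(** Conformal sesquilinearity on lists: a nonempty [b] means that the entry is not the last one, so
    that [z] is the value of a genuine variable. *)
Definition conformal_fun (d : forall i, {linear V i -> V i}) F :=
  (forall a z x b, (0 < size b)%N ->
     F (a ++ (z, gpartial d x) :: b) = - z *: F (a ++ (z, x) :: b)) /\
  (forall a z x, F (a ++ [:: (z, gpartial d x)]) =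
     gpartial d (F (a ++ [:: (z, x)])) + weight a *: F (a ++ [:: (z, x)])).

Lemma circ_conformal d m F G : slot_linear F -> slot_linear G -> G [::] = 0 ->
  conformal_fun d F -> conformal_fun d G -> conformal_fun d (circ m F G).
Proof.
move=> linF linG G0 [confF tailF] [confG tailG].
have partial0 := linear_at0 (gpartial_linear d).
have partialD := linear_addE (gpartial_linear d).
split=> [a z x b b_gt0|a z x]; rewrite !circ_insert.
  rewrite !scalerDr; congr (_ + _ + _).
  - rewrite deconc3Z; apply: eq_deconc3 => c e f _.
    exact: confF.
  - rewrite deconcZ; apply: eq_deconc => c e _.
    rewrite deconcZ; apply: eq_deconc => f h eqb.
    (* If [x] is the last argument of [G], the factor [- (weight e + z)] from [F] and the factor
       [weight e] from [G] add up to [- z]. *)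
    case: f eqb => [|y f] /= eqb; last by rewrite confG// slotZ.
    rewrite tailG slotD// slotZ// confF ?eqb// -scalerDl weight_nil addr0.
    by rewrite opprD addrAC addNr add0r.
  - rewrite deconc3Z; apply: eq_deconc3 => c e f _.
    by rewrite koszul_gpartial confF// size_cat addnS.
(* With nothing to the right of [x], a piece lying there is empty and [G [::] = 0] removes the
   term. *)
have nil0 y : F (map (kappa m) a ++ [:: (z, y); (weight [::], G [::])]) = 0.
  by rewrite G0 -cat_rcons slot0.
rewrite /= !deconc3_nil !nil0 !addr0 partialD scalerDr addrACA; congr (_ + _).
  rewrite deconc3Z (deconc3_morph _ _ partial0 partialD) -deconc3D.
  apply: eq_deconc3 => c e f <-.
  by rewrite tailF !weight_cat weight_cons weight_kappa.
rewrite deconcZ (deconc_morph _ _ partial0 partialD) -deconcD.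
apply: eq_deconc => c e <-.
rewrite !addr0 tailG slotD// tailF slotZ// weight_kappa -addrA -scalerDl.
by rewrite weight_cat.
Qed.

Lemma circ_graded n m F G :
  graded_fun n F -> graded_fun m G -> graded_fun (n + m) (circ m F G).
Proof.
move=> grF grG s e gs; apply: deconc3_ind => [|x y|a b c eqs].
- exact: homogeneous0.
- exact: homogeneousD.
move: gs; rewrite -eqs => /graded_args_cat[i ga /graded_args_cat[j gb gc]].
rewrite [n + m]addrC addrA; apply: grF; apply/graded_args_cat.
exists i; first exact: graded_args_kappa.
exists (j + m); first exact: grG.
by rewrite [e + m - i]addrAC opprD addrACA subrr addr0.
Qed.

Lemma circ_nil m F G : slot_linear F -> G [::] = 0 -> circ m F G [::] = 0.
Proof. by move=> linF G0; rewrite /circ deconc3_nil G0 slot0. Qed.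

End CompositionProduct.

(** * Evaluation of vector polynomials *)

Section Evaluation.
Variables (K : fieldType) (W : lmodType K).
Implicit Types (z : nat -> K) (w : W).

(** Points are sequences indexed by [nat], so that one assignment serves polynomials in any number
    of variables. *)
Definition lpoly_eval n z (P : lpoly W n) : W :=
  \sum_(a \in [set: 'X_{1..n}]) (\prod_(j < n) z j ^+ a j) *: P a.

Definition mpoly_eval n z (q : {mpoly K[n]}) : K := q.@[fun j : 'I_n => z j].

Lemma lpoly_eval_linear n z : linear (@lpoly_eval n z).
Proof.
apply: (@fsum_dirsum_linear K _ (fun _ : 'X_{1..n} => W) W
  (fun a w => (\prod_(j < n) z j ^+ a j) *: w)) => a k u w.
by rewrite scalerDr !scalerA mulrC.
Qed.

Lemma lpoly_eval_lmono n z a w :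
  lpoly_eval z (@lmono K W n a w) = (\prod_(j < n) z j ^+ a j) *: w.
Proof.
apply: (@fsum_dirinj K _ (fun _ : 'X_{1..n} => W) W
  (fun a w => (\prod_(j < n) z j ^+ a j) *: w)) => b.
exact: scaler0.
Qed.

Lemma lpoly_eval_ltens n z (q : {mpoly K[n]}) w :
  lpoly_eval z (ltens q w) = mpoly_eval z q *: w.
Proof.
rewrite /ltens (linear_sumE (lpoly_eval_linear z)) /mpoly_eval mevalE scaler_suml.
by apply: eq_bigr => a _; rewrite lpoly_eval_lmono scalerA mulrC.
Qed.

Lemma ltens0 n (q : {mpoly K[n]}) : ltens q (0 : W) = 0.
Proof. exact: (linear_at0 (ltens_linear q)). Qed.

Lemma lscale_lmono n (q : {mpoly K[n]}) a w :
  lscale q (lmono a w) = ltens (q * 'X_[a]) w.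
Proof.
apply: (@fsum_dirinj K _ (fun _ : 'X_{1..n} => W) _
  (fun a w => ltens (q * 'X_[a]) w)).
by move=> b; rewrite ltens0.
Qed.

Lemma lpoly_eval_lscale n z (q : {mpoly K[n]}) (P : lpoly W n) :
  lpoly_eval z (lscale q P) = mpoly_eval z q *: lpoly_eval z P.
Proof.
move: P.
apply: (@linear_dirsum_ext K _ (fun _ : 'X_{1..n} => W) W) => [k x y|k x y|a w].
- by rewrite lscale_linear lpoly_eval_linear.
- by rewrite lpoly_eval_linear scalerDr !scalerA mulrC.
rewrite -/(lmono a w) lscale_lmono lpoly_eval_ltens lpoly_eval_lmono scalerA.
by rewrite /mpoly_eval mevalM mevalX.
Qed.

Lemma lsubst_linear n p (f : 'I_n -> {mpoly K[p]}) : linear (@lsubst K W n p f).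
Proof.
apply: (@fsum_dirsum_linear K _ (fun _ : 'X_{1..n} => W) _
  (fun a w => ltens (\prod_j f j ^+ a j) w)) => a; exact: ltens_linear.
Qed.

Lemma lpoly_eval_lsubst n p z (y : nat -> K) (f : 'I_n -> {mpoly K[p]})
    (P : lpoly W n) :
  (forall j : 'I_n, mpoly_eval z (f j) = y j) ->
  lpoly_eval z (lsubst f P) = lpoly_eval y P.
Proof.
move=> fy; move: P.
apply: (@linear_dirsum_ext K _ (fun _ : 'X_{1..n} => W) W) => [k u v||a w].
- by rewrite lsubst_linear lpoly_eval_linear.
- exact: lpoly_eval_linear.
rewrite -/(lmono a w) lpoly_eval_lmono /lsubst.
rewrite (@fsum_dirinj K _ (fun _ : 'X_{1..n} => W) _
  (fun a w => ltens (\prod_j f j ^+ a j) w)) => [|b]; last exact: ltens0.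
rewrite lpoly_eval_ltens /mpoly_eval rmorph_prod; congr (_ *: _).
by apply: eq_bigr => j _; rewrite rmorphXn /= -fy.
Qed.

Lemma lextend_linear n (g : W -> lpoly W n) : linear g -> linear (lextend g).
Proof.
move=> ling; apply: (@fsum_dirsum_linear K _ (fun _ : 'X_{1..n} => W) _
    (fun a w => lscale 'X_[a] (g w))) => a k u v.
by rewrite ling lscale_linear.
Qed.

(** Evaluation turns the coefficientwise extension into plain application; linearity of [g] lets the
    monomial factor pass through it. *)
Lemma lpoly_eval_lextend n z (g : W -> lpoly W n) (P : lpoly W n) : linear g ->
  lpoly_eval z (lextend g P) = lpoly_eval z (g (lpoly_eval z P)).
Proof.
move=> ling; move: P.
apply: (@linear_dirsum_ext K _ (fun _ : 'X_{1..n} => W) W) => [k u v|k u v|a w].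
- by rewrite lextend_linear// lpoly_eval_linear.
- by rewrite lpoly_eval_linear ling lpoly_eval_linear.
rewrite -/(lmono a w) /lextend (@fsum_dirinj K _ (fun _ : 'X_{1..n} => W) _
  (fun a w => lscale 'X_[a] (g w))) => [|b]; last first.
  by rewrite (linear_at0 ling) (linear_at0 (lscale_linear _)).
rewrite lpoly_eval_lscale lpoly_eval_lmono (linear_scaleE ling).
by rewrite (linear_scaleE (lpoly_eval_linear z)) /mpoly_eval mevalX.
Qed.

(** * Recovering a polynomial from its values *)

Hypothesis charK : [pchar K] =i pred0.

(** In characteristic 0 the nodes [0, ..., N - 1] are distinct, so their Vandermonde matrix is
    invertible; the inverse of its transpose gives the coefficients. *)
Lemma Vandermonde_dual N : exists C : 'I_N -> 'I_N -> K,
  forall i j : 'I_N, \sum_x C i x * (x%:R) ^+ j = (i == j)%:R.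
Proof.
pose A := Vandermonde N (\row_(x < N) (x%:R : K)).
have unitA : A^T \in unitmx.
  rewrite unitmx_tr unitmxE det_Vandermonde unitfE.
  apply/prodf_neq0 => i _; apply/prodf_neq0 => j ltij; rewrite !mxE.
  rewrite -natrB ?(ltnW ltij)//.
  by rewrite ((pcharf0P K).1 charK) subn_eq0 -ltnNge.
exists (fun i x => invmx A^T i x) => i j.
have := congr1 (fun B : 'M_N => B i j) (mulVmx unitA); rewrite !mxE => <-.
by apply: eq_bigr => x _; rewrite !mxE.
Qed.

(* The coefficients of a polynomial are linear combinations of its values: the
   dual basis of the monomials on a grid is a product of univariate ones. *)
Lemma lpoly_interpolation n (P : lpoly W n) a :
  exists (I : finType) (c : I -> K) (z : I -> nat -> K),
    P a = \sum_i c i *: lpoly_eval (z i) P.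
Proof.
have [A suppA] := dirsum_support P.
(* [N] bounds every exponent in [a] and in a finite set containing the support of [P]. *)
pose N := (\max_(b <- a :: A) \max_(j < n) b j)%N.
have leN b (j : 'I_n) : b \in a :: A -> (b j < N.+1)%N.
  move=> bA; rewrite ltnS; apply: leq_trans (leq_bigmax_seq _ bA isT).
  exact: leq_bigmax.
have [C CE] := Vandermonde_dual N.+1.
(* A grid point has coordinates among [0, ..., N]; the default 0 lies beyond the [n] variables. *)
pose point (f : {ffun 'I_n -> 'I_N.+1}) j : K :=
  if insub j is Some i then (f i : nat)%:R else 0.
exists {ffun 'I_n -> 'I_N.+1}, (fun f => \prod_j C (inord (a j)) (fun_of_fin f j)).
exists point.
have evE z : lpoly_eval z P = \sum_(b <- A) (\prod_(j < n) z j ^+ b j) *: P b.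
  by rewrite /lpoly_eval (@fsbigTE _ _ _ _ A) // => b /suppA->; rewrite scaler0.
under eq_bigr do rewrite evE scaler_sumr.
rewrite exchange_big /=.
transitivity (\sum_(b <- A) (a == b)%:R *: P b).
  have [aA|naA] := boolP (a \in A).
    rewrite (big_fsetD1 _ aA) eqxx scale1r big_seq big1 => [|b]; first exact/esym/addr0.
    by rewrite in_fsetD1 eq_sym => /andP[/negPf-> _]; rewrite scale0r.
  rewrite suppA// big_seq big1// => b bA.
  by have [eqab|_] := eqVneq a b; [rewrite eqab bA in naA|rewrite scale0r].
apply: eq_big_seq => b bA; under eq_bigr do rewrite scalerA -big_split.
rewrite -scaler_suml /=; congr (_ *: _).
(* Distributivity turns the sum over grid points into a product of univariate sums, each a Kronecker
   delta. *)
transitivity (\prod_(j < n) \sum_x C (inord (a j)) x * x%:R ^+ b j).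
  have sumE (j : 'I_n) :
      \sum_x C (inord (a j)) x * x%:R ^+ b j = (a j == b j)%:R.
    have := CE (inord (a j)) (inord (b j)).
    by rewrite -val_eqE /= !inordK// leN// inE ?eqxx ?bA ?orbT.
  under eq_bigr do rewrite sumE.
  have [<-|nab] := eqVneq a b; first by rewrite big1 // => j _; rewrite eqxx.
  have [j nj] : exists j, a j != b j.
    apply/existsP; apply: contraNT nab; rewrite negb_exists => /forallP eqab.
    by apply/eqP/mnmP => j; apply/eqP; rewrite -[_ == _]negbK.
  by rewrite (bigD1 j)//= (negPf nj) mul0r.
rewrite bigA_distr_bigA; apply: eq_bigr => f _; apply: eq_bigr => j _ /=.
by rewrite /point valK.
Qed.

Lemma lpoly_eval_inj n (P Q : lpoly W n) :
  (forall z, lpoly_eval z P = lpoly_eval z Q) -> P = Q.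
Proof.
move=> eqPQ; apply/eqP; rewrite -subr_eq0; apply/eqP/dirsumP => a.
have [I [c [z ->]]] := lpoly_interpolation (P - Q) a.
rewrite big1// => i _.
rewrite (linear_addE (lpoly_eval_linear _)) (linear_oppE (lpoly_eval_linear _)).
by rewrite eqPQ subrr scaler0.
Qed.

End Evaluation.

Lemma lpoly_eval_gpartial (K : fieldType) (V : int -> lmodType K)
    (d : forall i, {linear V i -> V i}) n z (P : lpoly (dirsum V) n) :
  lpoly_eval z (gpartial_poly d P) = gpartial d (lpoly_eval z P).
Proof.
move: P; apply: (@linear_dirsum_ext K _ (fun _ : 'X_{1..n} => dirsum V) (dirsum V)).
- by move=> k u v; rewrite gpartial_poly_linear lpoly_eval_linear.
- by move=> k u v; rewrite lpoly_eval_linear gpartial_linear.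
move=> a w; rewrite -/(lmono a w) lpoly_eval_lmono (linear_scaleE (gpartial_linear d)).
rewrite /gpartial_poly (@fsum_dirinj K _ (fun _ : 'X_{1..n} => dirsum V) _
  (fun a w => lmono a (gpartial d w))) ?lpoly_eval_lmono// => b.
by rewrite (linear_at0 (gpartial_linear d)) /lmono (linear_at0 (@dirinj_linear _ _ _ _)).
Qed.

(** * Cochains as functions of lists *)

Section CochainFunctions.
Variables (K : fieldType) (V : int -> lmodType K).
Variable d : forall i, {linear V i -> V i}.
Local Notation W := (dirsum V).
Local Notation E := (K * W)%type.
Local Notation e0 := ((0, 0) : E).
Implicit Types (s a b c : seq E) (z : nat -> K).

Definition cochain_family : Type := forall k, cochain V k.

(* An argument list [(z_0, v_0); ...; (z_k, v_k)] carries the arguments together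
   with the values of the variables; [z_k] is a dummy. *)
Definition cochain_eval k (phi : cochain V k) s : W :=
  lpoly_eval (fun i => (nth e0 s i).1) (phi (fun i => (nth e0 s i).2)).

(** The length of the list selects the arity. No cochain takes zero arguments, whence the value 0 on
    the empty list. *)
Definition family_eval (rho : cochain_family) s : W :=
  if size s is k.+1 then cochain_eval (rho k) s else 0.

Lemma family_evalE rho s k :
  size s = k.+1 -> family_eval rho s = cochain_eval (rho k) s.
Proof. by rewrite /family_eval => ->. Qed.

Lemma eq_lpoly_eval n z (y : nat -> K) (P : lpoly W n) :
  (forall i, (i < n)%N -> z i = y i) -> lpoly_eval z P = lpoly_eval y P.
Proof.
move=> eqzy; apply: eq_fsbigr => a _; congr (_ *: _).
by apply: eq_bigr => j _; rewrite eqzy.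
Qed.

Lemma cochain_evalE k (phi : cochain V k) s z v :
  (forall i, (i < k)%N -> (nth e0 s i).1 = z i) ->
  (forall i : 'I_k.+1, (nth e0 s i).2 = v i) ->
  cochain_eval phi s = lpoly_eval z (phi v).
Proof.
move=> eqz eqv; rewrite /cochain_eval (eq_lpoly_eval _ eqz).
by congr (lpoly_eval z (phi _)); apply: funext.
Qed.

Definition args k z (v : 'I_k.+1 -> W) : seq E :=
  map (fun i : 'I_k.+1 => (z i, v i)) (enum 'I_k.+1).

Lemma size_args k z v : size (@args k z v) = k.+1.
Proof. by rewrite size_map size_enum_ord. Qed.

Lemma nth_args k z v (i : 'I_k.+1) : nth e0 (args z v) i = (z i, v i).
Proof. by rewrite (nth_map i) ?size_enum_ord// nth_ord_enum. Qed.

Lemma family_eval_args rho k z (v : 'I_k.+1 -> W) :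
  family_eval rho (args z v) = lpoly_eval z (rho k v).
Proof.
rewrite (family_evalE _ (size_args z v)); apply: cochain_evalE => i.
  by move=> ltik; rewrite (nth_args z v (widen_ord (leqnSn k) (Ordinal ltik))).
by rewrite nth_args.
Qed.

Lemma args_split k z (v : 'I_k.+1 -> W) (i : 'I_k.+1) x :
  args z [eta v with i |-> x] =
  take i (args z v) ++ (z i, x) :: drop i.+1 (args z v).
Proof.
apply: (@eq_from_nth _ e0) => [|j].
  by rewrite size_cat /= size_drop size_takel !size_args; have := ltn_ord i; lia.
rewrite size_args => ltjk; rewrite (nth_args _ _ (Ordinal ltjk)) /=.
have -> : (Ordinal ltjk == i) = (j == i) by [].
rewrite nth_cat size_takel; last by rewrite size_args ltnW.
case: ltngtP => [ltji|ltij|->].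
- by rewrite nth_take// (nth_args _ _ (Ordinal ltjk)).
- have -> : (j - i = (j - i.+1).+1)%N by lia.
  rewrite /= nth_drop; have -> : (i.+1 + (j - i.+1) = j)%N by lia.
  by rewrite (nth_args _ _ (Ordinal ltjk)).
by rewrite subnn.
Qed.

Lemma args_slot k z (v : 'I_k.+1 -> W) (i : 'I_k.+1) :
  args z v = take i (args z v) ++ (z i, v i) :: drop i.+1 (args z v).
Proof.
rewrite -args_split; congr args; apply: funext => j /=.
by have [->|] := eqVneq.
Qed.

Lemma nth_slot a (z : K) x y b j :
  nth e0 (a ++ (z, x) :: b) j =
  if j == size a then (z, x) else nth e0 (a ++ (z, y) :: b) j.
Proof.
rewrite !nth_cat; case: ltngtP => // [|->]; last by rewrite subnn.
by rewrite -subn_gt0; case: (j - size a)%N.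
Qed.

(** Presents a list with one varying entry as an update of a fixed argument function, the form used
    by [multilinear] and [conformal_sesquilinear]; the entry [y] of the base list is arbitrary. *)
Lemma cochain_eval_slot k (phi : cochain V k) a (z : K) x y b (i : 'I_k.+1) :
  i = size a :> nat ->
  cochain_eval phi (a ++ (z, x) :: b) =
  lpoly_eval (fun j => (nth e0 (a ++ (z, y) :: b) j).1)
    (phi [eta (fun j => (nth e0 (a ++ (z, y) :: b) j).2) with i |-> x]).
Proof.
move=> eqi; apply: cochain_evalE => [j _|j]; rewrite (nth_slot _ _ _ y) -eqi.
  by case: eqP => // ->; rewrite eqi nth_cat ltnn subnn.
by rewrite /= -[j == i]/(j == i :> nat); case: eqP.
Qed.

Lemma mpoly_eval_X n z (i : 'I_n) : mpoly_eval z 'X_i = z i.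
Proof. exact: mevalXU. Qed.

Lemma mpoly_eval_sum n z (I : Type) (r : seq I) (F : I -> {mpoly K[n]}) :
  mpoly_eval z (\sum_(i <- r) F i) = \sum_(i <- r) mpoly_eval z (F i).
Proof. exact: rmorph_sum. Qed.

Lemma weightE s : weight s = \sum_(i < size s) (nth e0 s i).1.
Proof. by rewrite /weight (big_nth e0) big_mkord. Qed.

Lemma lpoly_eval_homogeneous n z (P : lpoly W n) e :
  (forall m, homogeneous e (P m)) -> homogeneous e (lpoly_eval z P).
Proof.
move=> homP j nj; rewrite /lpoly_eval; have [A suppA] := dirsum_support P.
rewrite (@fsbigTE _ _ _ _ A) => [|b /suppA->]; last exact: scaler0.
rewrite (linear_sumE (dirsum_comp_linear j)) big1// => b _.
by rewrite dirsumZE homP ?scaler0.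
Qed.

Lemma graded_args_nth s e : graded_args s e -> exists2 f : nat -> int,
  forall i, (i < size s)%N -> homogeneous (f i) (nth e0 s i).2 &
  e = \sum_(i < size s) f i.
Proof.
elim: s e => [|x s IHs] e /=; first by move=> ->; exists (fun=> 0); rewrite ?big_ord0.
move=> [i hx /IHs[f hf eqe]]; exists (fun j => if j is j'.+1 then f j' else i).
  by case=> [|j] //; rewrite ltnS => /hf.
by rewrite big_ord_recl /= -eqe addrC subrK.
Qed.

Lemma graded_args_args k z (v : 'I_k.+1 -> W) (e : 'I_k.+1 -> int) :
  (forall i, homogeneous (e i) (v i)) -> graded_args (args z v) (\sum_i e i).
Proof.
move=> hv; rewrite -big_enum /args /=; elim: (enum _) => [|i r IHr] /=.
  by rewrite big_nil.
by exists (e i) => //; rewrite big_cons addrAC subrr add0r.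
Qed.

Lemma family_eval_slot_linear n (rho : cochain_family) :
  (forall k, rho k \in @cs_cochain K V d n k) ->  slot_linear (family_eval rho).
Proof.
move=> csrho a z b c x y; pose k := (size a + size b)%N.
have sz t : size (a ++ (z, t) :: b) = k.+1 by rewrite size_cat addnS.
have [multi _ _] := asboolP _ (csrho k).
have lti : (size a < k.+1)%N by rewrite ltnS leq_addr.
rewrite !(family_evalE _ (sz _)) !(@cochain_eval_slot _ _ _ _ _ 0 _ (Ordinal lti))//.
by rewrite multi lpoly_eval_linear.
Qed.

Lemma family_eval_conformal n (rho : cochain_family) :
  (forall k, rho k \in @cs_cochain K V d n k) ->  conformal_fun d (family_eval rho).
Proof.
move=> csrho; split=> [a z x b b_gt0|a z x].
  pose k := (size a + size b)%N.
  have sz t : size (a ++ (z, t) :: b) = k.+1 by rewrite size_cat addnS.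
  have [_ [conf _] _] := asboolP _ (csrho k).
  have lti : (size a < k)%N by rewrite -[ltnLHS]addn0 ltn_add2l.
  rewrite !(family_evalE _ (sz _)).
  rewrite (@cochain_eval_slot _ _ _ _ _ x _ (widen_ord (leqnSn k) (Ordinal lti)))//.
  have /= := conf (fun j => (nth e0 (a ++ (z, x) :: b) j).2) (Ordinal lti).
  rewrite nth_cat ltnn subnn /= => ->.
  rewrite (linear_oppE (lpoly_eval_linear _)) lpoly_eval_lscale mpoly_eval_X /=.
  by rewrite nth_cat ltnn subnn scaleNr.
have sz t : size (a ++ [:: (z, t)]) = (size a).+1 by rewrite size_cat addn1.
have [_ [_ conf] _] := asboolP _ (csrho (size a)).
rewrite !(family_evalE _ (sz _)) (@cochain_eval_slot _ _ _ _ _ x _ ord_max)//.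
have /= := conf (fun j => (nth e0 (a ++ [:: (z, x)]) j).2).
rewrite nth_cat ltnn subnn /= => ->.
rewrite (linear_addE (lpoly_eval_linear _)) lpoly_eval_gpartial lpoly_eval_lscale.
rewrite mpoly_eval_sum weightE; congr (_ + _ *: _).
by apply: eq_bigr => i _; rewrite mpoly_eval_X nth_cat ltn_ord.
Qed.

Lemma family_eval_graded n (rho : cochain_family) :
  (forall k, rho k \in @cs_cochain K V d n k) ->  graded_fun n (family_eval rho).
Proof.
move=> csrho s e /graded_args_nth[f hf ->]; case eqs: (size s) => [|k].
  by rewrite /family_eval eqs; exact: homogeneous0.
have [_ _ hom] := asboolP _ (csrho k).
rewrite (family_evalE _ eqs); apply: lpoly_eval_homogeneous => a.
by apply: (hom _ (fun i : 'I_k.+1 => f i)) => i; apply: hf; rewrite eqs.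
Qed.

Hypothesis charK : [pchar K] =i pred0.

Lemma family_eval_inj (rho vrho : cochain_family) :
  (forall s, family_eval rho s = family_eval vrho s) -> forall k, rho k = vrho k.
Proof.
move=> eq_eval k; apply: funext => v; apply: (lpoly_eval_inj charK) => z.
by rewrite -!family_eval_args.
Qed.

(** A converse to the three translations above. Polynomial identities are checked on values, and
    homogeneity passes from values to coefficients because the latter are combinations of the
    former. *)
Lemma cs_cochain_family n (rho : cochain_family) :
  slot_linear (family_eval rho) -> conformal_fun d (family_eval rho) ->
  graded_fun n (family_eval rho) -> forall k, rho k \in @cs_cochain K V d n k.
Proof.
move=> lin [conf tail] gr k; apply/asboolP; split.
- move=> v i a x y; apply: (lpoly_eval_inj charK) => z.
  by rewrite lpoly_eval_linear -!family_eval_args !args_split lin.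
- split=> [v i j|v]; apply: (lpoly_eval_inj charK) => z.
    rewrite (linear_oppE (lpoly_eval_linear _)) lpoly_eval_lscale mpoly_eval_X.
    rewrite -!family_eval_args args_split conf -?args_slot ?scaleNr//.
    by rewrite size_drop size_args subn_gt0 ltnS /=.
  rewrite (linear_addE (lpoly_eval_linear _)) lpoly_eval_gpartial lpoly_eval_lscale.
  have drop0 : drop k.+1 (args z v) = [::] by rewrite drop_oversize ?size_args.
  have last_arg := args_slot z v ord_max; rewrite drop0 in last_arg.
  rewrite mpoly_eval_sum -!family_eval_args args_split drop0 tail -last_arg.
  rewrite weightE size_takel ?size_args//; congr (_ + _ *: _).
  apply: eq_bigr => i _; rewrite mpoly_eval_X nth_take//.
  by rewrite (nth_args z v (widen_ord (leqnSn k) i)).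
move=> v e hv a; have [I [c [z ->]]] := lpoly_interpolation charK (rho k v) a.
apply: (big_ind (homogeneous _)) => [||i _]; [exact: homogeneous0|exact: homogeneousD|].
apply: homogeneousZ; rewrite -family_eval_args; apply: gr.
exact: graded_args_args.
Qed.

(** * The composition product in terms of lists *)

Section Diamond.
Variables (m : int) (k l : nat).
Variables (rho : cochain V k) (vrho : cochain V l).

Lemma mpoly_eval_lvar p z j : (j < p)%N -> mpoly_eval z (lvar K p j) = z j.
Proof. by move=> ltjp; rewrite /lvar insubT mpoly_eval_X. Qed.

(** Evaluating the substitutions turns slot [i] of the product into plugging the sublist of length
    [l.+1] starting at [i]. For [i = k] the scalar [weight t] is the dummy of the outer list. *)
Lemma cochain_eval_diamond s p : multilinear rho -> size s = p.+1 -> p = (k + l)%N ->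
  cochain_eval (diamond m rho vrho : cochain V p) s =
  \sum_(i < k.+1) (let t := take l.+1 (drop i s) in
    cochain_eval rho (map (kappa m) (take i s) ++
      (weight t, cochain_eval vrho t) :: drop (i + l.+1) s)).
Proof.
move=> multi sz eqp; rewrite {1}/cochain_eval (linear_sumE (lpoly_eval_linear _)).
apply: eq_bigr => i _; pose v (j : 'I_p.+1) := (nth e0 s j).2.
set z := fun _ => _; rewrite -/v.
have leik : (i <= k)%N by rewrite -ltnS.
have valE (j : nat) : (j <= k + l)%N -> v (inord j) = (nth e0 s j).2.
  by move=> lej; rewrite /v inordK// eqp.
have sizet : size (take l.+1 (drop i s)) = l.+1.
  by rewrite size_takel// size_drop sz; lia.
(* Multilinearity of [rho] makes the function of [w] linear, as evaluating [lextend] requires. *)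
rewrite lpoly_eval_lextend => [|a x y]; last first.
  have outerE w : outer_args m l i v w = [eta outer_args m l i v 0 with i |-> w].
    apply: funext => j /=; rewrite /outer_args.
    by have [->|] := eqVneq j i; rewrite ?ltnn.
  by rewrite (outerE (_ + _)) (outerE x) (outerE y) multi lsubst_linear.
cbv zeta; set w := lpoly_eval z (lsubst (inner_vars _ _ _) _); set t := take l.+1 _.
have -> : cochain_eval vrho t = w.
  rewrite /w (@lpoly_eval_lsubst _ _ _ _ _ (fun j => z (i + j)%N)) => [|j].
    apply: cochain_evalE => [j ltjl|j].
      by rewrite nth_take ?nth_drop// ltnS ltnW.
    by rewrite nth_take ?nth_drop// /inner_args valE//; have := ltn_ord j; lia.
  by rewrite mpoly_eval_lvar//; have := ltn_ord j; lia.
have lei : size (take i s) = i by rewrite size_takel// sz; lia.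
have nthE j :
    nth e0 (map (kappa m) (take i s) ++ (weight t, w) :: drop (i + l.+1) s) j =
    if (j < i)%N then kappa m (nth e0 s j) else if j == i then (weight t, w)
    else nth e0 s (j + l).
  rewrite nth_cat size_map lei; case: ltngtP => [ltji|ltij|->].
  - by rewrite (nth_map e0) ?lei// nth_take.
  - have -> : (j - i = (j - i.+1).+1)%N by lia.
    by rewrite /= nth_drop; congr (nth _ _ _); lia.
  - by rewrite subnn.
rewrite (@lpoly_eval_lsubst _ _ _ _ _ (fun j => (nth e0 (map (kappa m) (take i s) ++
  (weight t, w) :: drop (i + l.+1) s) j).1)) => [|j].
  rewrite [RHS]/cochain_eval; congr (lpoly_eval _ (rho _)).
  apply: funext => j; rewrite nthE /outer_args.
  have lejk : (j <= k)%N by rewrite -ltnS.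
  have -> : (j == i) = (j == i :> nat) by [].
  case: ltngtP => // ltij; first by rewrite valE ?(leq_trans lejk) ?leq_addr.
  by rewrite valE// leq_add2r.
rewrite nthE /outer_vars; have ltjk := ltn_ord j.
case: ltngtP => [ltji|ltij|eqji].
- by rewrite mpoly_eval_lvar// eqp; lia.
- by rewrite mpoly_eval_lvar// eqp; lia.
rewrite mpoly_eval_sum weightE sizet; apply: eq_bigr => h _.
have lth := ltn_ord h.
by rewrite mpoly_eval_lvar ?nth_take ?nth_drop//; lia.
Qed.

End Diamond.

Definition family_circ m (rho vrho : cochain_family) : cochain_family := fun p =>
  \sum_(k < p.+1) \sum_(l < p.+1 | (k + l == p)%N) diamond m (rho k) (vrho l).

Lemma cochain_eval_linear k s : linear (fun phi : cochain V k => cochain_eval phi s).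
Proof. by move=> a phi psi; rewrite /cochain_eval -lpoly_eval_linear. Qed.

(** Both sides sum over intervals of a list of length [p.+1], given by start and length: on the left
    the nonempty ones, grouped by [k] and [l]; on the right all of them, the empty ones vanishing by
    hypothesis. *)
Lemma exchange_intervals (M : nmodType) (T : nat -> nat -> M) p :
  (forall i, T i 0%N = 0) ->
  \sum_(k < p.+1) \sum_(l < p.+1 | (k + l == p)%N) \sum_(i < k.+1) T i l.+1 =
  \sum_(i < p.+2) \sum_(j < (p.+1 - i).+1) T i j.
Proof.
move=> T0.
(* Extension by zero gives the three indices the common range [p.+1], so that the sums can be
   exchanged. *)
pose G (k l i : nat) := if (k + l == p)%N && (i <= k)%N then T i l.+1 else 0.
transitivity (\sum_(k < p.+1) \sum_(l < p.+1) \sum_(i < p.+1) G k l i).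
  apply: eq_bigr => k _; rewrite big_mkcond; apply: eq_bigr => l _; rewrite /G.
  case: (k + l == p)%N; last by rewrite big1.
  by rewrite (big_ord_widen p.+1 (fun i => T i l.+1)) ?ltn_ord// -big_mkcond.
rewrite [RHS]big_ord_recr /= subnn big_ord1 T0 addr0.
under eq_bigr do rewrite exchange_big.
rewrite exchange_big; apply: eq_bigr => i _.
rewrite exchange_big [RHS]big_ord_recl T0 add0r.
rewrite (big_ord_widen p.+1 (fun l => T i l.+1)) ?leq_subr// [RHS]big_mkcond.
apply: eq_bigr => l _; rewrite /G; case: ltnP => lel; last first.
  by rewrite big1// => k _; case: ifP => // /andP[/eqP]; lia.
(* For fixed [l] only [k = p - l] contributes. *)
rewrite (bigD1 (inord (p - l))) //= inordK ?ltnS ?leq_subr//.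
rewrite big1 => [|k /eqP nk]; last first.
  by case: eqP => //= eqk; case: nk; apply: val_inj; rewrite /= inordK; lia.
by rewrite addr0 ifT//; lia.
Qed.

(** Arities [k], [l] and a slot [i] amount to the choice of a nonempty sublist, so the sum over them
    is a sum over three-piece factorizations. *)
Lemma family_eval_circ n m (rho vrho : cochain_family) s :
  (forall k, rho k \in @cs_cochain K V d n k) ->
  family_eval (family_circ m rho vrho) s =
  circ m (family_eval rho) (family_eval vrho) s.
Proof.
move=> csrho; have lin := family_eval_slot_linear csrho.
case eqs: (size s) => [|p].
  by rewrite (size0nil eqs) circ_nil.
rewrite (family_evalE _ eqs) (linear_sumE (cochain_eval_linear s)).
(* [T] does not mention the arities, which the lengths of the lists determine. *)
pose T i j := let t := take j (drop i s) in family_eval rho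
  (map (kappa m) (take i s) ++ (weight t, family_eval vrho t) :: drop (i + j) s).
transitivity (\sum_(k < p.+1) \sum_(l < p.+1 | (k + l == p)%N)
    \sum_(i < k.+1) T i l.+1).
  apply: eq_bigr => k _; rewrite (linear_sumE (cochain_eval_linear s)).
  apply: eq_bigr => l /eqP eqp; have [multi _ _] := asboolP _ (csrho k).
  rewrite (cochain_eval_diamond _ _ multi eqs (esym eqp)); apply: eq_bigr => i _.
  have lti := ltn_ord i; rewrite /T /= (@family_evalE vrho _ l); last first.
    by rewrite size_takel// size_drop eqs; lia.
  rewrite (@family_evalE rho _ k)// size_cat /= size_map size_drop size_takel eqs; lia.
rewrite exchange_intervals => [|i]; last by rewrite /T take0 slot0.
rewrite /circ /deconc3 deconcE eqs; apply: eq_bigr => i _.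
rewrite deconcE size_drop eqs; apply: eq_bigr => j _.
by rewrite /T drop_drop addnC.
Qed.

End CochainFunctions.

(** * The bracket *)

Section Jacobi.
Variables (K : fieldType) (V : int -> lmodType K).
Local Notation W := (dirsum V).
Local Notation E := (K * W)%type.
Implicit Types (F G H : seq E -> W) (n m l : int).

(** The graded commutator, with its summands ordered to fit the shape [k *: F + F'] of
    [circ_linearl] and [circ_linearr]. *)
Definition circ_bracket n m F G : seq E -> W :=
  fun s => - sgn K (m * n) *: circ n G F s + circ m F G s.

(** The sign bookkeeping of the Jacobi identity. The families [a], [b], [c] are the pre-Lie
    relations with outer function [F], [G], [H]; [p], [q], [r] are the signs of the degree pairs
    [(n, m)], [(n, l)], [(m, l)]. *)
Lemma Jacobi_signs (p q r : K) (a1 a2 a3 a4 b1 b2 b3 b4 c1 c2 c3 c4 : W) :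
  p * p = 1 ->
  a1 - a2 = r *: (a3 - a4) -> b1 - b2 = q *: (b3 - b4) ->
  c1 - c2 = p *: (c3 - c4) ->
  - (q * p) *: (- r *: c3 + b3) + (- r *: a4 + a2) =
  - (q * r) *: (- p *: c4 + c2) + (- p *: b1 + a1) +
  p *: (- (p * r) *: (- q *: c1 + a3) + (- q *: b4 + b2)).
Proof.
move=> pp1 /eqP; rewrite subr_eq => /eqP->; move=> /eqP; rewrite subr_eq => /eqP->.
move=> /eqP; rewrite subr_eq => /eqP->.
rewrite !(scalerDr, scalerN, scaleNr, opprK, opprD, scalerA, mulNr, mulrN).
rewrite !(mulrA p p) pp1 !mul1r.
have -> : q * p * r = r * q * p by rewrite [LHS]mulrC mulrA.
rewrite [q * r]mulrC [q * p]mulrC !addrA.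
(* Four terms survive and are put first; the other ten cancel in the five parenthesized pairs. *)
rewrite [RHS](ACl (9*3*7*8*(1*10)*(11*2)*(4*13)*(14*5)*(6*12))%AC) /=.
by rewrite !subrr !addr0.
Qed.

Lemma circ_bracket_Jacobi n m l F G H s :
  slot_linear F -> slot_linear G -> slot_linear H ->
  graded_fun n F -> graded_fun m G -> graded_fun l H ->
  circ_bracket n (m + l) F (circ_bracket m l G H) s =
  circ_bracket (n + m) l (circ_bracket n m F G) H s +
  sgn K (n * m) *: circ_bracket m (n + l) G (circ_bracket n l F H) s.
Proof.
move=> linF linG linH grF grG grH.
rewrite /circ_bracket !circ_linearl !circ_linearr//.
(* Signs of sums of degrees split into the three pairwise signs. *)
have -> : sgn K ((m + l) * n) = sgn K (n * l) * sgn K (n * m).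
  by rewrite -sgnD -mulrDr [m + l]addrC mulrC.
have -> : sgn K (l * (n + m)) = sgn K (n * l) * sgn K (m * l).
  by rewrite -sgnD mulrC mulrDl.
have -> : sgn K ((n + l) * m) = sgn K (n * m) * sgn K (m * l).
  by rewrite -sgnD mulrDl [l * m]mulrC.
rewrite [l * m]mulrC [m * n]mulrC [l * n]mulrC.
apply: Jacobi_signs; first exact: sgnK.
- exact: circ_prelie.
- exact: circ_prelie.
- exact: circ_prelie.
Qed.

End Jacobi.

(** * The bracket on the complex *)

Section Bracket.
Variables (K : fieldType) (V : int -> lmodType K).
Variable d : forall i, {linear V i -> V i}.
Hypothesis charK : [pchar K] =i pred0.
Local Notation W := (dirsum V).
Local Notation E := (K * W)%type.
Local Notation cs_deg := (cs_deg d).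

Definition cs_family n (rho : cs_deg n) : cochain_family V :=
  fun k => cs_hom_val (rho k).

Arguments cs_family [n] rho k.
Arguments family_circ [K V] m rho vrho p : rename.

Definition cs_eval n (rho : cs_deg n) : seq E -> W := family_eval (cs_family rho).

Lemma cs_familyP n (rho : cs_deg n) k : cs_family rho k \in @cs_cochain K V d n k.
Proof. exact: valP (rho k). Qed.

Lemma cs_eval_linear n s : linear (fun rho : cs_deg n => cs_eval rho s).
Proof.
move=> a rho vrho; rewrite /cs_eval /family_eval.
case: (size s) => [|k]; first by rewrite scaler0 addr0.
exact: cochain_eval_linear.
Qed.

Lemma cs_eval_slot_linear n (rho : cs_deg n) : slot_linear (cs_eval rho).
Proof. exact: family_eval_slot_linear (cs_familyP rho). Qed.

Lemma cs_eval_graded n (rho : cs_deg n) : graded_fun n (cs_eval rho).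
Proof. exact: family_eval_graded (cs_familyP rho). Qed.

Lemma cs_bracketE n m (rho : cs_deg n) (vrho : cs_deg m) p :
  cs_bracket rho vrho p =
  - sgn K (m * n) *: family_circ n (cs_family vrho) (cs_family rho) p +
  family_circ m (cs_family rho) (cs_family vrho) p.
Proof.
have -> : family_circ n (cs_family vrho) (cs_family rho) p =
    \sum_(k < p.+1) \sum_(l < p.+1 | (k + l == p)%N) diamond n (vrho l) (rho k).
  rewrite /family_circ (exchange_big_dep xpredT)//=; apply: eq_bigr => k _.
  by apply: eq_bigl => l; rewrite addnC.
rewrite scaler_sumr -big_split; apply: eq_bigr => k _.
rewrite scaler_sumr -big_split; apply: eq_bigr => l _.
by rewrite [RHS]addrC scaleNr.
Qed.

Lemma cs_eval_circ n m (rho : cs_deg n) (vrho : cs_deg m) :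
  family_eval (family_circ m (cs_family rho) (cs_family vrho)) =
  circ m (cs_eval rho) (cs_eval vrho).
Proof. by apply: funext => s; exact: family_eval_circ (cs_familyP rho). Qed.

(** Membership is checked on list functions, where [circ] preserves slot linearity, conformality and
    the grading. *)
Lemma family_circ_closed n m (rho : cs_deg n) (vrho : cs_deg m) p :
  family_circ m (cs_family rho) (cs_family vrho) p \in @cs_cochain K V d (n + m) p.
Proof.
have linF := cs_eval_slot_linear rho; have linG := cs_eval_slot_linear vrho.
apply: (cs_cochain_family charK); rewrite cs_eval_circ.
- exact: circ_slot_linear.
- apply: circ_conformal => //; first exact: family_eval_conformal (cs_familyP rho).
  exact: family_eval_conformal (cs_familyP vrho).
- by apply: circ_graded; exact: cs_eval_graded.
Qed.

Lemma cs_bracket_closed n m (rho : cs_deg n) (vrho : cs_deg m) p :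
  cs_bracket rho vrho p \in @cs_cochain K V d (n + m) p.
Proof.
rewrite cs_bracketE rpredD ?rpredZ//; last exact: family_circ_closed.
by rewrite addrC; exact: family_circ_closed.
Qed.

Definition hbracket n m (rho : cs_deg n) (vrho : cs_deg m) : cs_deg (n + m) :=
  fun p => CsHom (cs_bracket_closed rho vrho p).

Lemma cs_eval_hbracket n m (rho : cs_deg n) (vrho : cs_deg m) :
  cs_eval (hbracket rho vrho) = circ_bracket n m (cs_eval rho) (cs_eval vrho).
Proof.
apply: funext => s; case eqs: (size s) => [|p].
  rewrite (size0nil eqs) /circ_bracket !circ_nil ?scaler0 ?addr0//.
    exact: cs_eval_slot_linear.
  exact: cs_eval_slot_linear.
rewrite /cs_eval (family_evalE _ eqs) /cs_family /= cs_bracketE cochain_eval_linear.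
by rewrite -!(family_evalE _ eqs) !cs_eval_circ.
Qed.

(** Faithfulness of evaluation in characteristic 0: the identities in [cs_deg] below are reduced to
    identities of list functions. *)
Lemma cs_deg_ext n (rho vrho : cs_deg n) : cs_eval rho = cs_eval vrho -> rho = vrho.
Proof.
move=> eq_eval; apply: dirprodP => k; apply: val_inj.
apply: (family_eval_inj charK (rho := cs_family rho) (vrho := cs_family vrho)).
by move=> s; exact: (congr1 (@^~ s) eq_eval).
Qed.

Lemma cs_evalP n a (rho vrho : cs_deg n) :
  cs_eval (a *: rho + vrho) = fun s => a *: cs_eval rho s + cs_eval vrho s.
Proof. by apply: funext => s; exact: cs_eval_linear. Qed.

Lemma hbracket_linearl n m (vrho : cs_deg m) :
  linear (fun rho : cs_deg n => hbracket rho vrho).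
Proof.
move=> a rho rho'; apply: cs_deg_ext; rewrite cs_evalP !cs_eval_hbracket cs_evalP.
apply: funext => s; rewrite /circ_bracket circ_linearl circ_linearr; last first.
  exact: cs_eval_slot_linear.
by rewrite !scalerDr !scalerA [a * _]mulrC addrACA.
Qed.

Lemma hbracket_linearr n m (rho : cs_deg n) :
  linear (fun vrho : cs_deg m => hbracket rho vrho).
Proof.
move=> a vrho vrho'; apply: cs_deg_ext; rewrite cs_evalP !cs_eval_hbracket cs_evalP.
apply: funext => s; rewrite /circ_bracket circ_linearl circ_linearr; last first.
  exact: cs_eval_slot_linear.
by rewrite !scalerDr !scalerA [a * _]mulrC addrACA.
Qed.

Implicit Types x y : dirsum cs_deg.

Definition lie_bracket x y : dirsum cs_deg :=
  \sum_(n \in [set: int]) \sum_(m \in [set: int]) dirinj (hbracket (x n) (y m)).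

Lemma dirinj_hbracket0l n m (vrho : cs_deg m) :
  dirinj (hbracket (0 : cs_deg n) vrho) = 0 :> dirsum cs_deg.
Proof.
by rewrite (linear_at0 (hbracket_linearl vrho)) (linear_at0 (@dirinj_linear _ _ _ _)).
Qed.

Lemma dirinj_hbracket0r n m (rho : cs_deg n) :
  dirinj (hbracket rho (0 : cs_deg m)) = 0 :> dirsum cs_deg.
Proof.
by rewrite (linear_at0 (hbracket_linearr rho)) (linear_at0 (@dirinj_linear _ _ _ _)).
Qed.

Lemma lie_bracket_dirinj n m (rho : cs_deg n) (vrho : cs_deg m) :
  lie_bracket (dirinj rho) (dirinj vrho) = dirinj (hbracket rho vrho).
Proof.
rewrite /lie_bracket (@fsum_dirinj K _ cs_deg _ (fun n rho =>
    \sum_(m \in [set: int]) dirinj (hbracket rho ((dirinj vrho : dirsum cs_deg) m)))).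
  apply: (@fsum_dirinj K _ cs_deg _ (fun m vrho => dirinj (hbracket rho vrho))) => k.
  exact: dirinj_hbracket0r.
by move=> k; apply: fsbig1 => j _; exact: dirinj_hbracket0l.
Qed.

Lemma lie_bracket_linearr x : linear (lie_bracket x).
Proof.
have [A suppA] := dirsum_support x.
(* A finite set containing the support of [x] gives the outer sum a range independent of [y], so
   linearity can be checked term by term. *)
have bracketE y : lie_bracket x y =
    \sum_(n <- A) \sum_(m \in [set: int]) dirinj (hbracket (x n) (y m)).
  apply: fsbigTE => n /suppA->.
  by apply: fsbig1 => m _; exact: dirinj_hbracket0l.
move=> a y y'; rewrite !bracketE scaler_sumr -big_split; apply: eq_bigr => n _.
apply: (@fsum_dirsum_linear K _ cs_deg _ (fun m vrho => dirinj (hbracket (x n) vrho))).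
by move=> m b vrho vrho'; rewrite hbracket_linearr dirinj_linear.
Qed.

Lemma lie_bracket_linearl y : linear (lie_bracket^~ y).
Proof.
have [A suppA] := dirsum_support y.
(* Here it is the inner sum that gets a finite range independent of [x]. *)
have bracketE x : lie_bracket x y =
    \sum_(n \in [set: int]) \sum_(m <- A) dirinj (hbracket (x n) (y m)).
  apply: eq_fsbigr => n _; apply: fsbigTE => m /suppA->.
  exact: dirinj_hbracket0r.
move=> a x x' /=; rewrite !bracketE.
apply: (@fsum_dirsum_linear K _ cs_deg _
  (fun n rho => \sum_(m <- A) dirinj (hbracket rho (y m)))) => n b rho rho'.
rewrite scaler_sumr -big_split; apply: eq_bigr => m _.
by rewrite hbracket_linearl dirinj_linear.
Qed.

(** Degrees such as [n + m] and [m + n] are equal but not convertible, so elements of the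
    corresponding components are compared after injection, through their list functions. *)
Lemma dirinj_ext n n' (rho : cs_deg n) (rho' : cs_deg n') :
  n = n' -> cs_eval rho = cs_eval rho' ->
  dirinj rho = dirinj rho' :> dirsum cs_deg.
Proof. by move=> eqn; subst n' => /cs_deg_ext->. Qed.

(** Replaces a transport along [n = n'] by an element with the same list function. *)
Lemma cs_deg_cast n n' (rho : cs_deg n) :
  n = n' -> exists rho' : cs_deg n', cs_eval rho' = cs_eval rho.
Proof. by move=> eqn; subst n'; exists rho. Qed.

Lemma lie_bracket_graded_Lie : graded_Lie_algebra lie_bracket.
Proof.
split=> [||n m x y hx hy|n m x y hx hy|n m l x y z hx hy hz].
- exact: lie_bracket_linearl.
- exact: lie_bracket_linearr.
- rewrite (homogeneousE hx) (homogeneousE hy) lie_bracket_dirinj.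
  exact: homogeneous_dirinj.
- rewrite (homogeneousE hx) (homogeneousE hy) !lie_bracket_dirinj -scaleNr.
  rewrite -(linear_scaleE (@dirinj_linear _ _ cs_deg _)).
  apply: dirinj_ext; first exact: addrC.
  apply: funext => s; rewrite (linear_scaleE (cs_eval_linear s)) !cs_eval_hbracket.
  rewrite /circ_bracket scalerDr scalerA mulrNN [m * n]mulrC.
  by rewrite -[(-1) ^ _]/(sgn K _) sgnK scale1r addrC.
rewrite (homogeneousE hx) (homogeneousE hy) (homogeneousE hz) !lie_bracket_dirinj.
set rho := x n; set sig := y m; set tau := z l.
(* The three terms sit in degrees [n + (m + l)], [n + m + l] and [m + (n + l)]; the latter two are
   moved to the first. *)
have [pi piE] := cs_deg_cast (hbracket sig (hbracket rho tau)) (addrCA m n l).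
rewrite -(dirinj_ext (esym (addrCA m n l)) piE).
have [chi chiE] := cs_deg_cast (hbracket (hbracket rho sig) tau) (esym (addrA n m l)).
rewrite -(dirinj_ext (addrA n m l) chiE).
rewrite [RHS]addrC; transitivity (dirinj (sgn K (n * m) *: pi + chi)); last first.
  exact: (@dirinj_linear K _ cs_deg).
congr dirinj; apply: cs_deg_ext; rewrite cs_evalP.
apply: funext => s; rewrite piE chiE !cs_eval_hbracket [RHS]addrC.
by apply: circ_bracket_Jacobi;
  solve [exact: cs_eval_slot_linear | exact: cs_eval_graded].
Qed.

End Bracket.

Theorem proposition3p9 (R : realType) (V : int -> lmodType R[i])
    (d : forall i, {linear V i -> V i}) :
  exists br : cs_complex d -> cs_complex d -> cs_complex d,
    (forall (n m : int) (rho : cs_deg d n) (vrho : cs_deg d m) (p : nat),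
       cs_hom_val (br (dirinj rho) (dirinj vrho) (n + m) p) =
       cs_bracket rho vrho p) /\
    graded_Lie_algebra br.
Proof.
(* [R[i]] is a numeric domain, hence of characteristic 0. *)
have charC : [pchar R[i]] =i pred0 := @pchar_num _.
exists (lie_bracket charC); split; last exact: lie_bracket_graded_Lie.
by move=> n m rho vrho p; rewrite lie_bracket_dirinj dirinj_in.
Qed.
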